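(* Assume (A1) and (A2). There is an absolute constant $c$ such that if $n\ge c\,\bar\kappa^2r^2\log k/\tau^2$, then with high probability the maximizer $x_{\mathrm{MLE}}$ of $f$ over $\Delta_R$ satisfies $$\|\hat A x_{\mathrm{MLE}}-\hat A x^*\|_1\le\widetilde O\big(\sqrt{r/n}\big)\quad\text{and}\quad \|x_{\mathrm{MLE}}-x^*\|_1\le\widetilde O\big(\bar\kappa\sqrt{r/n}\big).$$
   Context: $A\in\mathbb{R}^{D\times k}$ is a word-topic matrix (nonnegative entries, columns summing to $1$). $x^*\in\{z\in\mathbb{R}^k_{\ge0}:\sum z_i=1\}$; a document of $n$ words $w_1,\dots,w_n$ is drawn i.i.d. from the categorical distribution on $[D]$ with probabilities $Ax^*$. Assumption (A1): $R=\mathrm{supp}(x^* )$ has $|R|\le r$ and $x^*_i\ge\tau/r$ for all $i\in R$, where $\tau\in(0,1]$. Assumption (A2): for every $r$-sparse $v\in\mathbb{R}^k$, $\|Av\|_1\ge\|v\|_1/\bar\kappa$. Vectors supported on $R$ are identified with vectors in $\mathbb{R}^R$; in particular $x^*\in\mathbb{R}^R$. $\hat A\in\mathbb{R}^{D\times R}$ is the submatrix of $A$ with columns in $R$, and $\hat a_w\in\mathbb{R}^R$ is its $w$-th row. $\Delta_R=\{x\in\mathbb{R}^R_{\ge0}:\sum_i x_i=1\}$. The restricted log-likelihood is $f(x)=\sum_{t=1}^n\log\langle\hat a_{w_t},x\rangle$. ''With high probability'' means with probability $1-o(1)$ as $k\to\infty$, and $\widetilde O(\cdot)$ hides constant and polylogarithmic-in-$k$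 factors. *)

(* Defs.v *)
From Stdlib Require Import Reals Lra List ClassicalEpsilon.
Import ListNotations.
Open Scope R_scope.

Fixpoint rsum (n : nat) (f : nat -> R) : R :=
  match n with O => 0 | S m => rsum m f + f m end.

Definition word_topic (D k : nat) (A : nat -> nat -> R) : Prop :=
  (forall w i, (w < D)%nat -> (i < k)%nat -> 0 <= A w i) /\
  (forall i, (i < k)%nat -> rsum D (fun w => A w i) = 1).

Definition in_simplex (k : nat) (x : nat -> R) : Prop :=
  (forall i, (i < k)%nat -> 0 <= x i) /\ rsum k x = 1.

Definition sparse (k r : nat) (v : nat -> R) : Prop :=
  exists S : list nat, (length S <= r)%nat /\
    forall i, (i < k)%nat -> v i <> 0 -> In i S.

Definition in_supp (k : nat) (x : nat -> R) (i : nat) : Prop :=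
  (i < k)%nat /\ 0 < x i.

Definition assumption_A1 (k r : nat) (tau : R) (xs : nat -> R) : Prop :=
  sparse k r xs /\ forall i, in_supp k xs i -> tau / INR r <= xs i.

Definition assumption_A2 (D k r : nat) (kappa : R) (A : nat -> nat -> R) : Prop :=
  forall v : nat -> R, sparse k r v ->
    rsum k (fun i => Rabs (v i)) / kappa <=
    rsum D (fun w => Rabs (rsum k (fun i => A w i * v i))).

Definition in_DeltaR (k : nat) (xs x : nat -> R) : Prop :=
  (forall i, (i < k)%nat -> 0 <= x i) /\
  (forall i, (i < k)%nat -> ~ in_supp k xs i -> x i = 0) /\
  rsum k x = 1.

Definition inner (k : nat) (A : nat -> nat -> R) (w : nat) (x : nat -> R) : R :=
  rsum k (fun i => A w i * x i).

(* f(x) = sum_t log <a_{w_t}, x>  (only meaningful where all inner products > 0;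
   elsewhere f = -infinity) *)
Definition loglik (k : nat) (A : nat -> nat -> R) (doc : list nat) (x : nat -> R) : R :=
  fold_right (fun w acc => ln (inner k A w x) + acc) 0 doc.

Definition finite_lik (k : nat) (A : nat -> nat -> R) (doc : list nat) (x : nat -> R) : Prop :=
  forall w, In w doc -> 0 < inner k A w x.

(* x is a maximizer of f over Delta_R (with f = -oo where some inner product is 0) *)
Definition is_MLE (k : nat) (A : nat -> nat -> R) (xs : nat -> R) (doc : list nat)
  (x : nat -> R) : Prop :=
  in_DeltaR k xs x /\ finite_lik k A doc x /\
  forall y, in_DeltaR k xs y -> finite_lik k A doc y ->
    loglik k A doc y <= loglik k A doc x.

Definition dist_Ax (D k : nat) (A : nat -> nat -> R) (x xs : nat -> R) : R :=
  rsum D (fun w => Rabs (inner k A w x - inner k A w xs)).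
Definition dist_x (k : nat) (x xs : nat -> R) : R :=
  rsum k (fun i => Rabs (x i - xs i)).

Definition indicator (P : Prop) : R :=
  if excluded_middle_informative P then 1 else 0.

(* Probability that a document of n i.i.d. words, word w drawn with
   probability p w (w < D), satisfies the event E. *)
Fixpoint probE (p : nat -> R) (D n : nat) (E : list nat -> Prop) : R :=
  match n with
  | O => indicator (E [])
  | S m => rsum D (fun w => p w * probE p D m (fun s => E (w :: s)))
  end.

Definition word_dist (k : nat) (A : nat -> nat -> R) (xs : nat -> R) : nat -> R :=
  fun w => inner k A w xs.

(* Main.v *)
(** Write [q = A xs], [z = (A x - q) / q] for a point [x], [psi z = z / (2 + z)] and
    [h2 z = E_q (z^2 / (2 + z))], a Hellinger-type distance with [(E|z|)^2 <= 2 h2 z].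
    Comparing the maximizer with the points of the segment towards [xs] gives
    [sum_t psi (a z (w_t)) >= 0] for all [0 <= a <= 1], while [E psi (z) = - h2 z / 2].
    If [n * h2 z] exceeded [lam = O (s log k)], with [s] the size of the support, scale
    [z] down until [n * h2] is between [lam / 6] and [lam]; the lower bound on [n] and
    (A2) then give [|z| <= s] pointwise, so in an L2(q)-orthonormal basis of the
    mean-zero span (of dimension at most [s]) [z] has coordinates that are polynomial in [k]
    multiples of [delta = 1 / (s sqrt n)].  Rounding them to the lattice of step [delta]
    lowers [sum_t psi] by a second-order term at most, which Markov's inequality controls,
    and [E exp (psi / 16) <= exp (- h2 / 64)] excludes all the [k^O(s)] lattice points by a
    union bound.  Measuring the rounding in this basis keeps the loss polylogarithmic
    in [k], uniformly in [n], [D], [kappa] and [tau]. *)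
Require Import Defs.
From Stdlib Require Import Reals List Lra Lia Rtopology ClassicalEpsilon.
Import ListNotations.
Open Scope R_scope.

(** * Finite sums and expectations over documents *)

Lemma rsum_ext (n : nat) (f g : nat -> R) :
  (forall i, (i < n)%nat -> f i = g i) -> rsum n f = rsum n g.
Proof.
  induction n as [|n IH]; intros H; simpl; [reflexivity|].
  rewrite IH, (H n); auto.
Qed.

Lemma rsum_le (n : nat) (f g : nat -> R) :
  (forall i, (i < n)%nat -> f i <= g i) -> rsum n f <= rsum n g.
Proof.
  induction n as [|n IH]; intros H; simpl; [lra|].
  apply Rplus_le_compat; auto.
Qed.

Lemma rsum_zero (n : nat) : rsum n (fun _ => 0) = 0.
Proof. induction n as [|n IH]; simpl; lra. Qed.

Lemma rsum_nonneg (n : nat) (f : nat -> R) :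
  (forall i, (i < n)%nat -> 0 <= f i) -> 0 <= rsum n f.
Proof. intros H; rewrite <- (rsum_zero n); now apply rsum_le. Qed.

Lemma rsum_plus (n : nat) (f g : nat -> R) :
  rsum n (fun i => f i + g i) = rsum n f + rsum n g.
Proof. induction n as [|n IH]; simpl; lra. Qed.

Lemma rsum_scal (n : nat) (a : R) (f : nat -> R) :
  rsum n (fun i => a * f i) = a * rsum n f.
Proof. induction n as [|n IH]; simpl; [|rewrite IH]; ring. Qed.

Lemma rsum_minus (n : nat) (f g : nat -> R) :
  rsum n (fun i => f i - g i) = rsum n f - rsum n g.
Proof. induction n as [|n IH]; simpl; lra. Qed.

Lemma rsum_const (n : nat) (a : R) : rsum n (fun _ => a) = INR n * a.
Proof.
  induction n as [|n IH]; [simpl; ring|].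
  rewrite S_INR; simpl; rewrite IH; ring.
Qed.

Lemma rsum_swap (m n : nat) (f : nat -> nat -> R) :
  rsum m (fun i => rsum n (fun j => f i j)) =
  rsum n (fun j => rsum m (fun i => f i j)).
Proof.
  induction m as [|m IH]; simpl; [now rewrite rsum_zero|].
  now rewrite IH, rsum_plus.
Qed.

Lemma Rabs_rsum (n : nat) (f : nat -> R) :
  Rabs (rsum n f) <= rsum n (fun i => Rabs (f i)).
Proof.
  induction n as [|n IH]; simpl; [rewrite Rabs_R0; lra|].
  eapply Rle_trans; [apply Rabs_triang|lra].
Qed.

Lemma rsum_term_le (n : nat) (f : nat -> R) (j : nat) :
  (forall i, (i < n)%nat -> 0 <= f i) -> (j < n)%nat -> f j <= rsum n f.
Proof.
  induction n as [|n IH]; intros H Hj; simpl; [lia|].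
  destruct (Nat.eq_dec j n) as [->|Hne].
  - assert (0 <= rsum n f) by (apply rsum_nonneg; auto). lra.
  - assert (f j <= rsum n f) by (apply IH; auto; lia).
    assert (0 <= f n) by auto. lra.
Qed.

(** Expectation under the law [q] of one word. Words of mass zero contribute nothing, so pointwise
    hypotheses are asked only where [0 < q w]. *)
Definition Ex (D : nat) (q g : nat -> R) : R := rsum D (fun w => q w * g w).

Lemma Ex_le (D : nat) (q f g : nat -> R) :
  (forall w, (w < D)%nat -> 0 <= q w) ->
  (forall w, (w < D)%nat -> 0 < q w -> f w <= g w) -> Ex D q f <= Ex D q g.
Proof.
  intros Hq H; apply rsum_le; intros w Hw.
  destruct (Hq w Hw) as [Hp|<-]; [|lra].
  apply Rmult_le_compat_l; auto; lra.
Qed.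

Lemma Ex_ext (D : nat) (q f g : nat -> R) :
  (forall w, (w < D)%nat -> 0 <= q w) ->
  (forall w, (w < D)%nat -> 0 < q w -> f w = g w) -> Ex D q f = Ex D q g.
Proof. intros Hq H; apply Rle_antisym; apply Ex_le; intros; auto; rewrite H; auto; lra. Qed.

Lemma Ex_plus (D : nat) (q f g : nat -> R) :
  Ex D q (fun w => f w + g w) = Ex D q f + Ex D q g.
Proof. unfold Ex; rewrite <- rsum_plus; apply rsum_ext; intros; ring. Qed.

Lemma Ex_scal (D : nat) (q : nat -> R) (a : R) (f : nat -> R) :
  Ex D q (fun w => a * f w) = a * Ex D q f.
Proof. unfold Ex; rewrite <- rsum_scal; apply rsum_ext; intros; ring. Qed.

Lemma Ex_const (D : nat) (q : nat -> R) (a : R) :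
  rsum D q = 1 -> Ex D q (fun _ => a) = a.
Proof.
  intros H; unfold Ex.
  rewrite (rsum_ext D _ (fun w => a * q w)) by (intros; ring).
  rewrite rsum_scal, H; ring.
Qed.

Lemma Ex_nonneg (D : nat) (q f : nat -> R) :
  (forall w, (w < D)%nat -> 0 <= q w) ->
  (forall w, (w < D)%nat -> 0 < q w -> 0 <= f w) -> 0 <= Ex D q f.
Proof.
  intros Hq H; apply rsum_nonneg; intros w Hw.
  destruct (Hq w Hw) as [Hp|<-]; [|lra].
  apply Rmult_le_pos; auto; lra.
Qed.

Lemma Ex_rsum (D n : nat) (q : nat -> R) (f : nat -> nat -> R) :
  Ex D q (fun w => rsum n (fun j => f j w)) = rsum n (fun j => Ex D q (f j)).
Proof.
  unfold Ex.
  rewrite (rsum_swap n D); apply rsum_ext; intros w _; now rewrite rsum_scal.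
Qed.

Lemma Ex_sq_zero (D : nat) (q f : nat -> R) (w : nat) :
  (forall w, (w < D)%nat -> 0 <= q w) ->
  Ex D q (fun w => f w * f w) = 0 -> (w < D)%nat -> 0 < q w -> f w = 0.
Proof.
  intros Hq H Hw Hp.
  assert (Hle : q w * (f w * f w) <= 0).
  { rewrite <- H. apply (rsum_term_le D (fun w => q w * (f w * f w))); auto.
    intros i Hi; apply Rmult_le_pos; auto; apply Rle_0_sqr. }
  destruct (Req_dec (f w) 0) as [|Hne]; auto.
  assert (0 < q w * (f w * f w)).
  { apply Rmult_lt_0_compat; auto; now apply Rsqr_pos_lt. }
  lra.
Qed.

(** * Sums and products over a document, and its law *)

Definition dsum (f : nat -> R) (d : list nat) : R :=
  fold_right (fun w acc => f w + acc) 0 d.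

Definition dprod (f : nat -> R) (d : list nat) : R :=
  fold_right (fun w acc => f w * acc) 1 d.

Lemma dsum_le (f g : nat -> R) (d : list nat) :
  (forall w, In w d -> f w <= g w) -> dsum f d <= dsum g d.
Proof.
  induction d as [|w d IH]; intros H; simpl; [lra|].
  apply Rplus_le_compat; [apply H; now left|apply IH; intros; apply H; now right].
Qed.

Lemma dsum_ext (f g : nat -> R) (d : list nat) :
  (forall w, In w d -> f w = g w) -> dsum f d = dsum g d.
Proof. intros H; apply Rle_antisym; apply dsum_le; intros; rewrite H; auto; lra. Qed.

Lemma dsum_plus (f g : nat -> R) (d : list nat) :
  dsum (fun w => f w + g w) d = dsum f d + dsum g d.
Proof. induction d as [|w d IH]; simpl; lra. Qed.

Lemma dsum_scal (a : R) (f : nat -> R) (d : list nat) :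
  dsum (fun w => a * f w) d = a * dsum f d.
Proof. induction d as [|w d IH]; simpl; [|rewrite IH]; ring. Qed.

Lemma dsum_nonneg (f : nat -> R) (d : list nat) :
  (forall w, In w d -> 0 <= f w) -> 0 <= dsum f d.
Proof.
  induction d as [|w d IH]; intros H; unfold dsum in *; simpl; [lra|].
  assert (0 <= f w) by (apply H; now left).
  assert (0 <= fold_right (fun w acc => f w + acc) 0 d)
    by (apply IH; intros; apply H; now right).
  lra.
Qed.

Lemma dprod_exp (f : nat -> R) (d : list nat) :
  dprod (fun w => exp (f w)) d = exp (dsum f d).
Proof. induction d as [|w d IH]; simpl; [now rewrite exp_0|]; now rewrite IH, exp_plus. Qed.

Definition lsum {T : Type} (l : list T) (f : T -> R) : R :=
  fold_right (fun a acc => f a + acc) 0 l.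

Lemma lsum_le_const {T : Type} (l : list T) (f : T -> R) (a : R) :
  (forall x, In x l -> f x <= a) -> lsum l f <= INR (length l) * a.
Proof.
  induction l as [|x l IH]; intros H; [unfold lsum; simpl; lra|].
  change (lsum (x :: l) f) with (f x + lsum l f).
  change (length (x :: l)) with (S (length l)); rewrite S_INR.
  assert (f x <= a) by (apply H; now left).
  assert (lsum l f <= INR (length l) * a) by (apply IH; intros; apply H; now right).
  lra.
Qed.

Lemma lsum_nonneg {T : Type} (l : list T) (f : T -> R) :
  (forall x, 0 <= f x) -> 0 <= lsum l f.
Proof.
  intros Hf; induction l as [|x l IH]; [unfold lsum; simpl; lra|].
  change (lsum (x :: l) f) with (f x + lsum l f); specialize (Hf x); lra.
Qed.

Lemma lsum_term_le {T : Type} (l : list T) (f : T -> R) (x : T) :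
  (forall x, 0 <= f x) -> In x l -> f x <= lsum l f.
Proof.
  intros Hf; induction l as [|y l IH]; intros Hx; [destruct Hx|].
  change (lsum (y :: l) f) with (f y + lsum l f).
  pose proof (lsum_nonneg l f Hf) as Hl.
  destruct Hx as [->|Hx]; [lra|].
  specialize (IH Hx); specialize (Hf y); lra.
Qed.

(** The recursion of [probE] with a real integrand in place of an event, so that Markov's inequality
    reduces to linearity and monotonicity. *)
Fixpoint expE (p : nat -> R) (D n : nat) (g : list nat -> R) : R :=
  match n with
  | O => g []
  | S m => rsum D (fun w => p w * expE p D m (fun s => g (w :: s)))
  end.

(** The support of the law of the document: integrands need to be compared only here. *)
Definition valid_doc (p : nat -> R) (D n : nat) (d : list nat) : Prop :=
  length d = n /\ forall w, In w d -> (w < D)%nat /\ 0 < p w.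

Lemma probE_expE (p : nat -> R) (D n : nat) (E : list nat -> Prop) :
  probE p D n E = expE p D n (fun d => indicator (E d)).
Proof.
  revert E; induction n as [|n IH]; intros E; simpl; [reflexivity|].
  apply rsum_ext; intros; now rewrite IH.
Qed.

Lemma expE_le (p : nat -> R) (D n : nat) (g h : list nat -> R) :
  (forall w, (w < D)%nat -> 0 <= p w) ->
  (forall d, valid_doc p D n d -> g d <= h d) -> expE p D n g <= expE p D n h.
Proof.
  intros Hp; revert g h; induction n as [|n IH]; intros g h H; simpl.
  - apply H; split; [reflexivity|intros w []].
  - apply (Ex_le D p); auto; intros w Hw Hpw; apply IH.
    intros d [Hl Hd]; apply H; split; [simpl; now rewrite Hl|].
    intros u [<-|Hu]; auto.
Qed.

Lemma expE_plus (p : nat -> R) (D n : nat) (g h : list nat -> R) :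
  expE p D n (fun d => g d + h d) = expE p D n g + expE p D n h.
Proof.
  revert g h; induction n as [|n IH]; intros g h; simpl; [reflexivity|].
  etransitivity; [|exact (Ex_plus D p (fun w => expE p D n (fun s => g (w :: s)))
    (fun w => expE p D n (fun s => h (w :: s))))].
  apply rsum_ext; intros; now rewrite IH.
Qed.

Lemma expE_scal (p : nat -> R) (D n : nat) (a : R) (g : list nat -> R) :
  expE p D n (fun d => a * g d) = a * expE p D n g.
Proof.
  revert g; induction n as [|n IH]; intros g; simpl; [reflexivity|].
  etransitivity; [|exact (Ex_scal D p a (fun w => expE p D n (fun s => g (w :: s))))].
  apply rsum_ext; intros; now rewrite IH.
Qed.

Lemma expE_const (p : nat -> R) (D n : nat) (a : R) :
  rsum D p = 1 -> expE p D n (fun _ => a) = a.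
Proof.
  intros Hp; induction n as [|n IH]; simpl; [reflexivity|].
  rewrite IH; now apply Ex_const.
Qed.

Lemma expE_lsum {T : Type} (p : nat -> R) (D n : nat) (l : list T)
  (F : T -> list nat -> R) : rsum D p = 1 ->
  expE p D n (fun d => lsum l (fun x => F x d)) = lsum l (fun x => expE p D n (F x)).
Proof.
  intros Hp; induction l as [|x l IH]; simpl; [now apply expE_const|].
  rewrite expE_plus; f_equal; exact IH.
Qed.

Lemma expE_rsum (p : nat -> R) (D n m : nat) (F : nat -> list nat -> R) :
  rsum D p = 1 ->
  expE p D n (fun d => rsum m (fun j => F j d)) = rsum m (fun j => expE p D n (F j)).
Proof.
  intros Hp; induction m as [|m IH]; simpl; [now apply expE_const|].
  now rewrite expE_plus, IH.
Qed.

(** Independence of the words. With [f = exp g] this is the moment generating function of a sum over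
    the document. *)
Lemma expE_dprod (p : nat -> R) (D n : nat) (f : nat -> R) :
  expE p D n (dprod f) = Ex D p f ^ n.
Proof.
  induction n as [|n IH]; [reflexivity|].
  assert (H : forall w, expE p D n (fun s => dprod f (w :: s)) = f w * Ex D p f ^ n).
  { intros w; rewrite <- IH; exact (expE_scal p D n (f w) (dprod f)). }
  change (rsum D (fun w => p w * expE p D n (fun s => dprod f (w :: s))) = Ex D p f ^ S n).
  rewrite (rsum_ext D _ (fun w => Ex D p f ^ n * (p w * f w)))
    by (intros; rewrite H; ring).
  rewrite rsum_scal; change (rsum D (fun w => p w * f w)) with (Ex D p f); simpl; ring.
Qed.

Lemma expE_dsum (p : nat -> R) (D n : nat) (f : nat -> R) :
  rsum D p = 1 -> expE p D n (dsum f) = INR n * Ex D p f.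
Proof.
  intros Hp; induction n as [|n IH]; [simpl; ring|].
  assert (H : forall w, expE p D n (fun s => dsum f (w :: s)) = f w + INR n * Ex D p f).
  { intros w; rewrite <- IH, <- (expE_const p D n (f w) Hp) at 1.
    exact (expE_plus p D n (fun _ => f w) (dsum f)). }
  change (rsum D (fun w => p w * expE p D n (fun s => dsum f (w :: s))) =
          INR (S n) * Ex D p f).
  rewrite (rsum_ext D _ (fun w => p w * (f w + INR n * Ex D p f)))
    by (intros; now rewrite H).
  change (Ex D p (fun w => f w + INR n * Ex D p f) = INR (S n) * Ex D p f).
  rewrite Ex_plus, Ex_const, S_INR by auto; ring.
Qed.

(** * The function psi and the Hellinger-type distance *)

Definition lincomb (m : nat) (e : nat -> nat -> R) (c : nat -> R) (w : nat) : R :=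
  rsum m (fun j => c j * e j w).

(** For a relative density [z = p / q - 1] this is [(p - q) / (p + q)], which stays between -1 and
    1. *)
Definition psi (z : R) : R := z / (2 + z).

(** For [z = p / q - 1] this is the triangular discrimination, the sum of [(p - q)^2 / (p + q)]. *)
Definition hsq (D : nat) (q z : nat -> R) : R :=
  Ex D q (fun w => z w * z w / (2 + z w)).

(** Since [psi y = 1 - 2 / (2 + y)], the first-order Taylor remainder is exactly [- 2 d^2 / (a^2 b)]
    with [a = 2 + y] and [b = a + d]. Both are at least [/ 2], which gives the factor 16. *)
Lemma psi_step (y d : R) :
  / 2 <= 2 + y -> / 2 <= 2 + (y + d) ->
  psi y + 2 / ((2 + y) * (2 + y)) * d <= psi (y + d) + 16 * (d * d).
Proof.
  intros Hy Hyd; unfold psi.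
  set (a := 2 + y) in *; set (b := 2 + (y + d)) in *.
  replace y with (a - 2) by (unfold a; ring).
  replace (a - 2 + d) with (b - 2) by (unfold a, b; ring).
  replace d with (b - a) by (unfold a, b; ring).
  clearbody a b.
  assert (H : (a - 2) / a + 2 / (a * a) * (b - a) =
    (b - 2) / b + 2 * ((b - a) * (b - a)) * (/ a * / a * / b)) by (field; lra).
  rewrite H.
  assert (Ha : 0 < / a <= 2).
  { split; [apply Rinv_0_lt_compat; lra|].
    rewrite <- (Rinv_inv 2); apply Rinv_le_contravar; lra. }
  assert (Hb : 0 < / b <= 2).
  { split; [apply Rinv_0_lt_compat; lra|].
    rewrite <- (Rinv_inv 2); apply Rinv_le_contravar; lra. }
  assert (Hs : 0 <= (b - a) * (b - a)) by apply Rle_0_sqr.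
  assert (/ a * / a <= 4) by nra.
  assert (0 < / a * / a) by nra.
  assert (Hp : / a * / a * / b <= 8) by nra.
  assert (0 <= (b - a) * (b - a) * (8 - / a * / a * / b)) by (apply Rmult_le_pos; lra).
  lra.
Qed.

(** [exp x <= 1 / (1 - x)], and [(1 - x) (1 + x + 2 x^2) = 1 + x^2 (1 - 2 x)] is at least 1. *)
Lemma exp_le_quadratic (x : R) : x <= / 2 -> exp x <= 1 + x + 2 * (x * x).
Proof.
  intros Hx.
  assert (H1 : 1 - x <= exp (- x)) by (pose proof (exp_ineq1_le (- x)); lra).
  assert (H2 : exp x * exp (- x) = 1) by (rewrite <- exp_plus, Rplus_opp_r; apply exp_0).
  pose proof (exp_pos x).
  assert (H3 : exp x * (1 - x) <= 1) by nra.
  assert (H4 : 1 <= (1 - x) * (1 + x + 2 * (x * x))).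
  { assert (0 <= x * x * (1 - 2 * x)) by (apply Rmult_le_pos; nra). nra. }
  apply Rmult_le_reg_r with (1 - x); lra.
Qed.

(* [psi z = z/2 - z^2/(2(2+z))] and [psi z ^2 <= 2 z^2/(2+z)]: the variance of
   [psi z] is controlled by its negative drift. *)
Lemma Ex_exp_psi (D : nat) (q z : nat -> R) :
  (forall w, (w < D)%nat -> 0 <= q w) -> rsum D q = 1 -> Ex D q z = 0 ->
  (forall w, (w < D)%nat -> 0 < q w -> / 2 <= 2 + z w) ->
  Ex D q (fun w => exp (/ 16 * psi (z w))) <= exp (- (/ 64 * hsq D q z)).
Proof.
  intros Hq H1 H0 Hz.
  apply Rle_trans with (Ex D q (fun w => 1 + (/ 32 * z w + - / 64 * (z w * z w / (2 + z w))))).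
  - apply Ex_le; auto; intros w Hw Hp; specialize (Hz w Hw Hp).
    set (a := 2 + z w) in *.
    assert (Hi : 0 < / a <= 2).
    { split; [apply Rinv_0_lt_compat; lra|].
      rewrite <- (Rinv_inv 2); apply Rinv_le_contravar; lra. }
    assert (Hpsi : psi (z w) = 1 - 2 * / a) by (unfold psi; fold a; unfold a; field; fold a; lra).
    eapply Rle_trans; [apply exp_le_quadratic; rewrite Hpsi; lra|].
    assert (Hd : psi (z w) = / 2 * z w - / 2 * (z w * z w / a))
      by (unfold psi; fold a; unfold a; field; fold a; lra).
    assert (Hsq : psi (z w) * psi (z w) = (z w * z w / a) * / a)
      by (unfold psi; fold a; field; lra).
    assert (Hn : 0 <= z w * z w / a).
    { apply Rmult_le_pos; [apply Rle_0_sqr|lra]. }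
    assert (psi (z w) * psi (z w) <= (z w * z w / a) * 2).
    { rewrite Hsq; apply Rmult_le_compat_l; lra. }
    fold a; nra.
  - rewrite Ex_plus, Ex_const, Ex_plus, !Ex_scal, H0 by auto; fold (hsq D q z).
    pose proof (exp_ineq1_le (- (/ 64 * hsq D q z))); lra.
Qed.

(** Cauchy-Schwarz with the weight [2 + z], whose mean is 2 because [z] has mean zero. This turns a
    bound on [hsq] into one on the L1 error. *)
Lemma Ex_abs_sq_le_hsq (D : nat) (q z : nat -> R) :
  (forall w, (w < D)%nat -> 0 <= q w) -> rsum D q = 1 -> Ex D q z = 0 ->
  (forall w, (w < D)%nat -> 0 < q w -> -1 <= z w) ->
  Ex D q (fun w => Rabs (z w)) * Ex D q (fun w => Rabs (z w)) <= 2 * hsq D q z.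
Proof.
  intros Hq H1 H0 Hz.
  set (X := Ex D q (fun w => Rabs (z w))).
  assert (Hh : 0 <= hsq D q z).
  { apply Ex_nonneg; auto; intros w Hw Hp; specialize (Hz w Hw Hp).
    apply Rmult_le_pos; [apply Rle_0_sqr|left; apply Rinv_0_lt_compat; lra]. }
  assert (HX : 0 <= X) by (apply Ex_nonneg; auto; intros; apply Rabs_pos).
  destruct HX as [HX|<-]; [|lra].
  assert (H : X <= Ex D q (fun w => / X * (z w * z w / (2 + z w)) + (/ 4 * X) * (2 + z w))).
  { apply Ex_le; auto; intros w Hw Hp; specialize (Hz w Hw Hp).
    (* AM-GM for [|z| = (|z| / sqrt (2 + z)) * sqrt (2 + z)] *)
    assert (Hsq : 0 <= (Rabs (z w) - / 2 * X * (2 + z w)) * (Rabs (z w) - / 2 * X * (2 + z w)))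
      by apply Rle_0_sqr.
    assert (Habs : Rabs (z w) * Rabs (z w) = z w * z w)
      by (rewrite <- Rabs_mult; apply Rabs_right, Rle_ge, Rle_0_sqr).
    apply Rmult_le_reg_r with (X * (2 + z w)); [apply Rmult_lt_0_compat; lra|].
    replace ((/ X * (z w * z w / (2 + z w)) + / 4 * X * (2 + z w)) * (X * (2 + z w)))
      with (z w * z w + / 4 * X * X * (2 + z w) * (2 + z w)) by (field; lra).
    nra. }
  rewrite Ex_plus, !Ex_scal, Ex_plus, Ex_const, H0 in H by auto.
  fold (hsq D q z) in H.
  assert (H2 : X * X <= (/ X * hsq D q z + / 4 * X * (2 + 0)) * X)
    by (apply Rmult_le_compat_r; lra).
  replace ((/ X * hsq D q z + / 4 * X * (2 + 0)) * X)
    with (hsq D q z + / 2 * (X * X)) in H2 by (field; lra).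
  lra.
Qed.

(** At the first index where [f] is at most [lam], the preceding value exceeds [lam], and one step
    divides by at most 6. *)
Lemma exists_dyadic_scale (f : nat -> R) (lam : R) :
  0 < lam -> (forall j, f (S j) <= / 2 * f j) -> (forall j, / 6 * f j <= f (S j)) ->
  lam < f O -> exists j, lam / 6 <= f j <= lam.
Proof.
  intros Hl Hup Hlo H0.
  assert (Hdec : forall j, f j <= (/ 2) ^ j * f O).
  { induction j as [|j IH]; simpl; [lra|]. specialize (Hup j); lra. }
  assert (Hstop : exists N, f N <= lam).
  { destruct (pow_lt_1_zero (/ 2)) with (y := lam / f O) as [N HN].
    - rewrite Rabs_right; lra.
    - apply Rdiv_lt_0_compat; lra.
    - exists N; specialize (HN N (le_n N)); rewrite Rabs_right in HN
        by (apply Rle_ge, pow_le; lra).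
      eapply Rle_trans; [apply Hdec|].
      apply Rmult_lt_compat_r with (r := f O) in HN; [|lra].
      unfold Rdiv in HN; rewrite Rmult_assoc, Rinv_l in HN; lra. }
  destruct Hstop as [N HN]; induction N as [|N IH]; [lra|].
  destruct (Rle_dec (f N) lam) as [Hle|Hgt]; [now apply IH|].
  exists (S N); specialize (Hlo N); lra.
Qed.

(** Halving [z] multiplies each term by [(2 + z) / (2 (4 + z))], which increases from [/ 6] at
    [z = -1] towards [/ 2]. *)
Lemma hsq_half (D : nat) (q z z' : nat -> R) :
  (forall w, (w < D)%nat -> 0 <= q w) ->
  (forall w, (w < D)%nat -> 0 < q w -> -1 <= z w) ->
  (forall w, z' w = / 2 * z w) ->
  / 6 * hsq D q z <= hsq D q z' <= / 2 * hsq D q z.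
Proof.
  intros Hq Hz Hz'; unfold hsq; rewrite <- !Ex_scal.
  split; apply Ex_le; auto; intros w Hw Hp; rewrite Hz'; specialize (Hz w Hw Hp).
  - apply Rmult_le_reg_r with ((2 + z w) * (2 + / 2 * z w)); [apply Rmult_lt_0_compat; lra|].
    replace (/ 6 * (z w * z w / (2 + z w)) * ((2 + z w) * (2 + / 2 * z w)))
      with ((z w * z w) * (/ 6 * (2 + / 2 * z w))) by (field; lra).
    replace (/ 2 * z w * (/ 2 * z w) / (2 + / 2 * z w) * ((2 + z w) * (2 + / 2 * z w)))
      with ((z w * z w) * (/ 4 * (2 + z w))) by (field; lra).
    apply Rmult_le_compat_l; [apply Rle_0_sqr|lra].
  - apply Rmult_le_reg_r with ((2 + z w) * (2 + / 2 * z w)); [apply Rmult_lt_0_compat; lra|].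
    replace (/ 2 * (z w * z w / (2 + z w)) * ((2 + z w) * (2 + / 2 * z w)))
      with ((z w * z w) * (/ 2 * (2 + / 2 * z w))) by (field; lra).
    replace (/ 2 * z w * (/ 2 * z w) / (2 + / 2 * z w) * ((2 + z w) * (2 + / 2 * z w)))
      with ((z w * z w) * (/ 4 * (2 + z w))) by (field; lra).
    apply Rmult_le_compat_l; [apply Rle_0_sqr|lra].
Qed.

Lemma lincomb_ext (m : nat) (e : nat -> nat -> R) (c c' : nat -> R) (w : nat) :
  (forall j, (j < m)%nat -> c j = c' j) -> lincomb m e c w = lincomb m e c' w.
Proof. intros H; apply rsum_ext; intros j Hj; now rewrite H. Qed.

Lemma lincomb_scal (m : nat) (e : nat -> nat -> R) (a : R) (c : nat -> R) (w : nat) :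
  lincomb m e (fun j => a * c j) w = a * lincomb m e c w.
Proof. unfold lincomb; rewrite <- rsum_scal; apply rsum_ext; intros; ring. Qed.

Lemma lincomb_closed (V : (nat -> R) -> Prop) (m : nat) (e : nat -> nat -> R) (c : nat -> R) :
  V (fun _ => 0) -> (forall x y a, V x -> V y -> V (fun w => x w + a * y w)) ->
  (forall j, (j < m)%nat -> V (e j)) -> V (lincomb m e c).
Proof.
  intros H0 Hc; induction m as [|m IH]; intros He; [exact H0|].
  apply (Hc (lincomb m e c) (e m) (c m)); auto.
Qed.

(** * Orthonormal bases *)

Definition orthonormal (D : nat) (q : nat -> R) (m : nat) (e : nat -> nat -> R) : Prop :=
  forall i j, (i < m)%nat -> (j < m)%nat ->
    Ex D q (fun w => e i w * e j w) = if Nat.eqb i j then 1 else 0.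

Lemma Ex_lincomb_mul (D : nat) (q : nat -> R) (m : nat) (e : nat -> nat -> R)
  (c f : nat -> R) :
  Ex D q (fun w => lincomb m e c w * f w) = rsum m (fun j => c j * Ex D q (fun w => e j w * f w)).
Proof.
  rewrite (rsum_ext m _ (fun j => Ex D q (fun w => c j * (e j w * f w))))
    by (intros; now rewrite Ex_scal).
  rewrite <- Ex_rsum; unfold Ex; apply rsum_ext; intros w _; f_equal.
  unfold lincomb; rewrite Rmult_comm, <- rsum_scal; apply rsum_ext; intros; ring.
Qed.

Lemma rsum_delta (m : nat) (c : nat -> R) (i : nat) : (i < m)%nat ->
  rsum m (fun j => c j * (if Nat.eqb j i then 1 else 0)) = c i.
Proof.
  induction m as [|m IH]; intros Hi; [lia|]; simpl.
  destruct (Nat.eqb_spec m i) as [->|Hne].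
  - rewrite (rsum_ext i _ (fun _ => 0)), rsum_zero; [ring|].
    intros j Hj; destruct (Nat.eqb_spec j i); [lia|ring].
  - rewrite IH by lia; ring.
Qed.

Lemma Ex_lincomb_basis (D : nat) (q : nat -> R) (m : nat) (e : nat -> nat -> R)
  (c : nat -> R) (i : nat) :
  orthonormal D q m e -> (i < m)%nat -> Ex D q (fun w => lincomb m e c w * e i w) = c i.
Proof.
  intros He Hi; rewrite Ex_lincomb_mul, <- (rsum_delta m c i Hi).
  apply rsum_ext; intros j Hj; now rewrite He.
Qed.

Lemma parseval (D : nat) (q : nat -> R) (m : nat) (e : nat -> nat -> R) (c : nat -> R) :
  orthonormal D q m e ->
  Ex D q (fun w => lincomb m e c w * lincomb m e c w) = rsum m (fun j => c j * c j).
Proof.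
  intros He; rewrite Ex_lincomb_mul; apply rsum_ext; intros j Hj; f_equal.
  rewrite <- (Ex_lincomb_basis D q m e c j He Hj); unfold Ex; apply rsum_ext; intros; ring.
Qed.

Lemma lincomb_add (m : nat) (e : nat -> nat -> R) (c c' : nat -> R) (w : nat) :
  lincomb m e (fun j => c j + c' j) w = lincomb m e c w + lincomb m e c' w.
Proof. unfold lincomb; rewrite <- rsum_plus; apply rsum_ext; intros; ring. Qed.

(** Overwrites one index: appends an entry after the first [m], or changes a single coordinate. *)
Definition extend {T : Type} (m : nat) (e : nat -> T) (x : T) (j : nat) : T :=
  if Nat.eqb j m then x else e j.

Lemma extend_eq {T : Type} (m : nat) (e : nat -> T) (x : T) : extend m e x m = x.
Proof. unfold extend; now rewrite Nat.eqb_refl. Qed.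

Lemma extend_lt {T : Type} (m : nat) (e : nat -> T) (x : T) (j : nat) :
  (j < m)%nat -> extend m e x j = e j.
Proof. intros H; unfold extend; destruct (Nat.eqb_spec j m); [lia|reflexivity]. Qed.

Lemma lincomb_extend (m : nat) (e : nat -> nat -> R) (x : nat -> R) (c : nat -> R)
  (a : R) (w : nat) :
  lincomb (S m) (extend m e x) (extend m c a) w = lincomb m e c w + a * x w.
Proof.
  unfold lincomb; simpl; rewrite !extend_eq; f_equal.
  apply rsum_ext; intros j Hj; now rewrite !extend_lt.
Qed.

Lemma orthonormal_extend (D : nat) (q : nat -> R) (m : nat) (e : nat -> nat -> R)
  (x : nat -> R) :
  orthonormal D q m e -> Ex D q (fun w => x w * x w) = 1 ->
  (forall j, (j < m)%nat -> Ex D q (fun w => x w * e j w) = 0) ->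
  orthonormal D q (S m) (extend m e x).
Proof.
  intros He Hx Hj i j Hi Hj'.
  destruct (Nat.eqb_spec i m) as [->|Hi']; destruct (Nat.eqb_spec j m) as [->|Hj''];
    rewrite ?extend_eq, ?extend_lt by lia.
  - now rewrite Nat.eqb_refl.
  - rewrite Hj by lia; destruct (Nat.eqb_spec m j); [lia|reflexivity].
  - destruct (Nat.eqb_spec i m); [lia|]; rewrite <- (Hj i) by lia.
    unfold Ex; apply rsum_ext; intros; ring.
  - apply He; lia.
Qed.

(** Gram-Schmidt in L2(q). The family is indexed by all of [[0, k)] but vanishes off [U], so the
    dimension is bounded by the size of the support. The linear class [V] later carries mean zero
    and the sup-norm bound over to the basis vectors. *)
Lemma gram_schmidt (D k : nat) (q : nat -> R) (V : (nat -> R) -> Prop) (U : nat -> bool)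
  (b : nat -> nat -> R) :
  (forall w, (w < D)%nat -> 0 <= q w) ->
  V (fun _ => 0) -> (forall x y a, V x -> V y -> V (fun w => x w + a * y w)) ->
  (forall i, (i < k)%nat -> V (b i)) ->
  (forall i w, U i = false -> b i w = 0) ->
  exists m e, (m <= length (filter U (seq 0 k)))%nat /\
    (forall j, (j < m)%nat -> V (e j)) /\ orthonormal D q m e /\
    forall i, (i < k)%nat -> exists c, forall w, (w < D)%nat -> 0 < q w ->
      b i w = lincomb m e c w.
Proof.
  intros Hq HV0 HVc; induction k as [|k IH]; intros Hb HU.
  { exists O, (fun _ _ => 0); repeat split; try (intros; lia); intros i j Hi; lia. }
  destruct IH as (m & e & Hm & HVe & He & Hrep); auto.
  rewrite seq_S, filter_app, length_app; simpl.
  assert (Hskip : forall c, (forall w, (w < D)%nat -> 0 < q w -> b k w = lincomb m e c w) ->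
    forall i, (i < S k)%nat -> exists c, forall w, (w < D)%nat -> 0 < q w ->
      b i w = lincomb m e c w).
  { intros c Hc i Hi; destruct (Nat.eq_dec i k) as [->|]; [now exists c|apply Hrep; lia]. }
  destruct (U k) eqn:HUk; simpl.
  2:{ exists m, e; repeat split; auto; [lia|]; apply (Hskip (fun _ => 0)); intros w _ _.
      rewrite HU by auto; unfold lincomb.
      rewrite (rsum_ext m _ (fun _ => 0)), rsum_zero by (intros; ring); reflexivity. }
  set (c := fun j => Ex D q (fun w => b k w * e j w)).
  set (res := fun w => b k w + -1 * lincomb m e c w).
  set (N := Ex D q (fun w => res w * res w)).
  assert (HN : 0 <= N) by (apply Ex_nonneg; auto; intros; apply Rle_0_sqr).
  (* A residual of zero norm puts [b k] in the span wherever [q] is positive; otherwise it is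
     normalised and appended. *)
  destruct HN as [HN|HN].
  2:{ exists m, e; repeat split; auto; [lia|]; apply (Hskip c); intros w Hw Hp.
      assert (Hr : res w = 0) by (apply (Ex_sq_zero D q res w); auto).
      unfold res in Hr; lra. }
  pose proof (sqrt_lt_R0 N HN) as Hs.
  (* The leading [0 +] gives the form [x w + a * y w] under which [V] is closed. *)
  set (x := fun w => 0 + / sqrt N * res w).
  assert (HVres : V res).
  { apply HVc; [apply Hb; lia|]. now apply lincomb_closed. }
  assert (Horth : forall j, (j < m)%nat -> Ex D q (fun w => res w * e j w) = 0).
  { intros j Hj.
    transitivity (Ex D q (fun w => b k w * e j w + -1 * (lincomb m e c w * e j w))).
    - unfold Ex; apply rsum_ext; intros; unfold res; ring.
    - rewrite Ex_plus, Ex_scal, (Ex_lincomb_basis D q m e c j) by auto; unfold c; ring. }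
  exists (S m), (extend m e x); repeat split; [lia| | |].
  - intros j Hj; destruct (Nat.eq_dec j m) as [->|];
      [rewrite extend_eq; now apply HVc|rewrite extend_lt by lia; apply HVe; lia].
  - apply orthonormal_extend; auto.
    + transitivity (Ex D q (fun w => / N * (res w * res w))).
      * unfold Ex; apply rsum_ext; intros w _; unfold x.
        rewrite <- (sqrt_sqrt N) at 3 by lra; rewrite Rinv_mult; ring.
      * rewrite Ex_scal; fold N; field; lra.
    + intros j Hj; transitivity (Ex D q (fun w => / sqrt N * (res w * e j w))).
      * unfold Ex; apply rsum_ext; intros; unfold x; ring.
      * rewrite Ex_scal, Horth by auto; ring.
  - intros i Hi; destruct (Nat.eq_dec i k) as [->|].
    + exists (extend m c (sqrt N)); intros w _ _; rewrite lincomb_extend; unfold x, res.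
      field; lra.
    + destruct (Hrep i) as [c' Hc']; [lia|].
      exists (extend m c' 0); intros w Hw Hp; rewrite lincomb_extend, Hc' by auto; ring.
Qed.

Lemma lincomb_span (D k m : nat) (q : nat -> R) (b e : nat -> nat -> R) (v : nat -> R) :
  (forall i, (i < k)%nat -> exists c, forall w, (w < D)%nat -> 0 < q w ->
    b i w = lincomb m e c w) ->
  exists c, forall w, (w < D)%nat -> 0 < q w -> lincomb k b v w = lincomb m e c w.
Proof.
  induction k as [|k IH]; intros H.
  - exists (fun _ => 0); intros w _ _; unfold lincomb; simpl.
    rewrite (rsum_ext m _ (fun _ => 0)), rsum_zero by (intros; ring); reflexivity.
  - destruct IH as [c Hc]; auto; destruct (H k) as [c' Hc']; auto.
    exists (fun j => c j + v k * c' j); intros w Hw Hp.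
    rewrite lincomb_add, lincomb_scal, <- Hc, <- Hc' by auto; reflexivity.
Qed.

(** * Rounding to a lattice *)

Definition grid (delta : R) (N : nat) : list R :=
  map (fun i => delta * (INR i - INR N)) (seq 0 (2 * N + 1)).

Lemma INR_floor (x : R) (N : nat) : 0 <= x < INR N ->
  exists i, (i < N)%nat /\ INR i <= x < INR i + 1.
Proof.
  induction N as [|N IH]; intros Hx; [simpl in Hx; lra|].
  destruct (Rlt_dec x (INR N)) as [Hlt|Hge].
  - destruct IH as (i & Hi & Hix); [lra|]; exists i; split; [lia|auto].
  - rewrite S_INR in Hx; exists N; split; [lia|lra].
Qed.

(** The neighbour above or below [c] is taken according to the sign of [G]. Strictness of the bound
    on [c] keeps the upper neighbour inside the grid. *)
Lemma grid_round (delta : R) (N : nat) (c G : R) :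
  0 < delta -> Rabs c < delta * INR N ->
  exists g, In g (grid delta N) /\ Rabs (g - c) <= delta /\ 0 <= (g - c) * G.
Proof.
  intros Hd Hc; apply Rabs_def2 in Hc; destruct Hc as [Hc1 Hc2].
  assert (HN : INR (2 * N) = 2 * INR N) by (rewrite mult_INR; simpl; ring).
  assert (Hcd : c = delta * (c / delta)) by (field; lra).
  destruct (INR_floor (c / delta + INR N) (2 * N)) as (i & Hi & Hi1 & Hi2).
  { rewrite HN; split.
    - assert (- INR N <= c / delta); [|lra].
      apply Rmult_le_reg_l with delta; lra.
    - assert (c / delta < INR N); [|lra].
      apply Rmult_lt_reg_l with delta; lra. }
  destruct (Rle_dec 0 G) as [HG|HG].
  - exists (delta * (INR (S i) - INR N)); split; [|split].
    + unfold grid; apply in_map_iff; exists (S i); split; [reflexivity|apply in_seq; lia].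
    + rewrite S_INR; apply Rabs_le; split; nra.
    + apply Rmult_le_pos; auto; rewrite S_INR; nra.
  - exists (delta * (INR i - INR N)); split; [|split].
    + unfold grid; apply in_map_iff; exists i; split; [reflexivity|apply in_seq; lia].
    + apply Rabs_le; split; nra.
    + assert (delta * (INR i - INR N) - c <= 0) by nra. nra.
Qed.

Lemma Rabs_le_inv (a b : R) : Rabs a <= b -> - b <= a <= b.
Proof.
  intros H; pose proof (Rle_abs a); pose proof (Rle_abs (- a)) as H'.
  rewrite Rabs_Ropp in H'; lra.
Qed.

Lemma lincomb_update (m : nat) (e : nat -> nat -> R) (c : nat -> R) (i : nat) (g : R)
  (w : nat) : (i < m)%nat ->
  lincomb m e (extend i c g) w = lincomb m e c w + (g - c i) * e i w.
Proof.
  unfold lincomb; induction m as [|m IH]; intros Hi; [lia|]; simpl.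
  destruct (Nat.eq_dec i m) as [<-|Hne].
  - rewrite extend_eq, (rsum_ext i _ (fun j => c j * e j w));
      [ring|intros j Hj; now rewrite extend_lt].
  - rewrite IH by lia; unfold extend; destruct (Nat.eqb_spec m i); [lia|ring].
Qed.

(* Coordinates are rounded one at a time; of the two neighbouring lattice values the one
   chosen makes the first-order change of the sum nonnegative. *)
Lemma round_coeffs (d : list nat) (m : nat) (e : nat -> nat -> R) (c : nat -> R)
  (delta : R) (N : nat) :
  0 < delta -> (forall j, (j < m)%nat -> Rabs (c j) < delta * INR N) ->
  (forall c', (forall j, (j < m)%nat -> Rabs (c' j - c j) <= delta) ->
     forall w, In w d -> / 2 <= 2 + lincomb m e c' w) ->
  forall i, (i <= m)%nat -> exists c',
    (forall j, (j < m)%nat -> Rabs (c' j - c j) <= delta) /\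
    (forall j, (j < i)%nat -> In (c' j) (grid delta N)) /\
    (forall j, (i <= j)%nat -> c' j = c j) /\
    dsum (fun w => psi (lincomb m e c w)) d <=
      dsum (fun w => psi (lincomb m e c' w)) d +
      16 * (delta * delta) * rsum i (fun j => dsum (fun w => e j w * e j w) d).
Proof.
  intros Hd Hc Hlow; induction i as [|i IH]; intros Hi.
  - exists c; repeat split; auto.
    + intros j _; replace (c j - c j) with 0 by ring; rewrite Rabs_R0; lra.
    + intros j Hj; lia.
    + simpl; lra.
  - destruct IH as (c' & Hc'1 & Hc'2 & Hc'3 & Hc'4); [lia|].
    set (y := lincomb m e c').
    (* [G] is the partial derivative of the sum of [psi] in coordinate [i] at the current point. *)
    set (G := dsum (fun w => 2 / ((2 + y w) * (2 + y w)) * e i w) d).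
    destruct (grid_round delta N (c i) G) as (g & Hg1 & Hg2 & Hg3); [auto|apply Hc; lia|].
    assert (Hci : c' i = c i) by (apply Hc'3; lia).
    assert (Hnear : forall j, (j < m)%nat -> Rabs (extend i c' g j - c j) <= delta).
    { intros j Hj; unfold extend; destruct (Nat.eqb_spec j i) as [->|]; auto. }
    exists (extend i c' g); repeat split; auto.
    + intros j Hj; unfold extend; destruct (Nat.eqb_spec j i); [auto|apply Hc'2; lia].
    + intros j Hj; unfold extend; destruct (Nat.eqb_spec j i); [lia|apply Hc'3; lia].
    + set (t := g - c i) in *.
      assert (Hstep : dsum (fun w => psi (y w)) d + t * G <=
        dsum (fun w => psi (lincomb m e (extend i c' g) w)) d +
        16 * (t * t) * dsum (fun w => e i w * e i w) d).
      { unfold G; rewrite <- !dsum_scal, <- !dsum_plus; apply dsum_le; intros w Hw.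
        pose proof (Hlow c' Hc'1 w Hw) as H1.
        pose proof (Hlow _ Hnear w Hw) as H2.
        rewrite lincomb_update, Hci in H2 |- * by lia; fold t in H2 |- *.
        change (lincomb m e c' w) with (y w) in *.
        pose proof (psi_step (y w) (t * e i w) H1 H2) as H3.
        replace (t * (2 / ((2 + y w) * (2 + y w)) * e i w))
          with (2 / ((2 + y w) * (2 + y w)) * (t * e i w)) by ring.
        replace (16 * (t * t) * (e i w * e i w))
          with (16 * (t * e i w * (t * e i w))) by ring.
        exact H3. }
      assert (Htt : t * t <= delta * delta).
      { apply Rabs_le_inv in Hg2; nra. }
      assert (Hsq : 0 <= dsum (fun w => e i w * e i w) d).
      { apply dsum_nonneg; intros; apply Rle_0_sqr. }
      assert (t * t * dsum (fun w => e i w * e i w) d <=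
              delta * delta * dsum (fun w => e i w * e i w) d)
        by (apply Rmult_le_compat_r; lra).
      simpl; unfold y in *; lra.
Qed.

(** Enumerates [G^m] by functions. Agreement below [m] suffices, since [lincomb m] reads only these
    coordinates. *)
Lemma coef_net (m : nat) (G : list R) : exists Net : list (nat -> R),
  length Net = (length G ^ m)%nat /\
  forall c, (forall j, (j < m)%nat -> In (c j) G) ->
    exists c', In c' Net /\ forall j, (j < m)%nat -> c' j = c j.
Proof.
  induction m as [|m (Net & Hlen & HNet)].
  - exists [fun _ => 0]; split; [reflexivity|]; intros c _.
    exists (fun _ => 0); split; [now left|intros; lia].
  - exists (map (fun p => extend m (fst p) (snd p)) (list_prod Net G)); split.
    + rewrite length_map, length_prod, Hlen; simpl; lia.
    + intros c Hc; destruct (HNet c) as (c' & Hc' & Heq); [intros; apply Hc; lia|].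
      exists (extend m c' (c m)); split.
      * apply in_map_iff; exists (c', c m); split; [reflexivity|].
        apply in_prod; auto.
      * intros j Hj; destruct (Nat.eq_dec j m) as [->|];
          [apply extend_eq|rewrite extend_lt by lia; apply Heq; lia].
Qed.

(** [x^2 <= 2 (x + t)^2 + 2 t^2]; the denominators [2 + x >= 1] and [2 + x + t] compare up to
    [3 / 2], whence [3 = 2 * 3 / 2]. *)
Lemma hsq_perturb (D : nat) (q z z' : nat -> R) :
  (forall w, (w < D)%nat -> 0 <= q w) ->
  (forall w, (w < D)%nat -> 0 < q w -> -1 <= z w /\ Rabs (z' w - z w) <= / 2) ->
  hsq D q z <= 3 * hsq D q z' + 2 * Ex D q (fun w => (z' w - z w) * (z' w - z w)).
Proof.
  intros Hq Hz; unfold hsq; rewrite <- !Ex_scal, <- Ex_plus; apply Ex_le; auto.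
  intros w Hw Hp; destruct (Hz w Hw Hp) as [Hz1 Hz2].
  set (t := z' w - z w) in *; replace (z' w) with (z w + t) by (unfold t; ring).
  apply Rabs_le_inv in Hz2; set (x := z w) in *; clearbody t x.
  assert (Ha : 0 < / (2 + x)) by (apply Rinv_0_lt_compat; lra).
  assert (Ha1 : / (2 + x) <= 1) by (rewrite <- Rinv_1; apply Rinv_le_contravar; lra).
  assert (Hcmp : / (2 + x) <= 3 / 2 * / (2 + (x + t))).
  { apply Rmult_le_reg_r with ((2 + x) * (2 + (x + t))); [apply Rmult_lt_0_compat; lra|].
    replace (/ (2 + x) * ((2 + x) * (2 + (x + t)))) with (2 + (x + t)) by (field; lra).
    replace (3 / 2 * / (2 + (x + t)) * ((2 + x) * (2 + (x + t)))) with (3 / 2 * (2 + x))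
      by (field; lra). lra. }
  assert (Hxx : x * x <= 2 * ((x + t) * (x + t)) + 2 * (t * t)).
  { assert (0 <= (x + 2 * t) * (x + 2 * t)) by apply Rle_0_sqr; nra. }
  assert (H1 : x * x / (2 + x) <= (2 * ((x + t) * (x + t)) + 2 * (t * t)) * / (2 + x))
    by (apply Rmult_le_compat_r; lra).
  assert (Hs1 : 0 <= (x + t) * (x + t)) by apply Rle_0_sqr.
  assert (Hs2 : 0 <= t * t) by apply Rle_0_sqr.
  assert ((x + t) * (x + t) * / (2 + x) <= (x + t) * (x + t) * (3 / 2 * / (2 + (x + t))))
    by (apply Rmult_le_compat_l; lra).
  assert (t * t * / (2 + x) <= t * t * 1) by (apply Rmult_le_compat_l; lra).
  unfold Rdiv at 2; lra.
Qed.

(** * Scaling, variance and lattice approximation *)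

Lemma Rabs_le_of_sq (x y : R) : 0 <= y -> x * x <= y * y -> Rabs x <= y.
Proof. intros Hy H; rewrite <- (Rabs_right y) by lra; now apply Rsqr_le_abs_0. Qed.

Lemma exp_pow_INR (x : R) (n : nat) : exp x ^ n = exp (INR n * x).
Proof.
  induction n as [|n IH]; [simpl; now rewrite Rmult_0_l, exp_0|].
  rewrite S_INR, Rmult_plus_distr_r, Rmult_1_l, exp_plus, <- IH; simpl; ring.
Qed.

(** The upper end of the window serves the sup and variance bounds, the lower end the exponential
    bound. Powers of [/ 2] stay among the factors [a] in [[0, 1]] for which the likelihood
    inequality is known. *)
Lemma exists_scale (D n : nat) (q z : nat -> R) (lam : R) :
  (forall w, (w < D)%nat -> 0 <= q w) ->
  (forall w, (w < D)%nat -> 0 < q w -> -1 <= z w) ->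
  0 < lam < INR n * hsq D q z ->
  exists a, 0 <= a <= 1 /\ lam / 6 <= INR n * hsq D q (fun w => a * z w) <= lam.
Proof.
  intros Hq Hz [Hl Hlam].
  assert (Ha : forall j, 0 <= (/ 2) ^ j <= 1).
  { induction j as [|j IH]; simpl; lra. }
  assert (Hhalf : forall j, / 6 * hsq D q (fun w => (/ 2) ^ j * z w) <=
      hsq D q (fun w => (/ 2) ^ S j * z w) <= / 2 * hsq D q (fun w => (/ 2) ^ j * z w)).
  { intros j; apply hsq_half; auto.
    - intros w Hw Hp; specialize (Hz w Hw Hp); specialize (Ha j).
      set (a := (/ 2) ^ j) in *; nra.
    - intros w; simpl; ring. }
  pose proof (pos_INR n) as Hn.
  destruct (exists_dyadic_scale (fun j => INR n * hsq D q (fun w => (/ 2) ^ j * z w)) lam)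
    as [j Hj]; auto.
  - intros j; destruct (Hhalf j); nra.
  - intros j; destruct (Hhalf j); nra.
  - replace (hsq D q (fun w => (/ 2) ^ 0 * z w)) with (hsq D q z); auto.
    unfold hsq; apply Ex_ext; auto; intros; simpl; now rewrite Rmult_1_l.
  - exists ((/ 2) ^ j); split; auto.
Qed.

(** The sup hypothesis and [(E|z|)^2 <= 2 hsq] give [n z^2 <= 2 K^2 n hsq <= n s], so [|z| <= s].
    Then [z^2 <= (2 + s) z^2 / (2 + z)], and [2 + s <= 3 s]. *)
Lemma sup_and_variance_bound (D n s : nat) (q z : nat -> R) (K L C : R) :
  (forall w, (w < D)%nat -> 0 <= q w) -> rsum D q = 1 -> Ex D q z = 0 ->
  (forall w, (w < D)%nat -> 0 < q w -> -1 <= z w) ->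
  (forall w, (w < D)%nat -> 0 < q w -> Rabs (z w) <= K * Ex D q (fun w => Rabs (z w))) ->
  (1 <= s)%nat -> 0 < INR n -> 2 * C * (K * K) * L <= INR n ->
  INR n * hsq D q z <= C * INR s * L ->
  INR n * Ex D q (fun w => z w * z w) <= 3 * INR s * (C * INR s * L).
Proof.
  intros Hq H1 H0 Hz Hsup Hs Hn HK Hlam.
  assert (Hs1 : 1 <= INR s) by (change 1 with (INR 1); apply le_INR; lia).
  set (X := Ex D q (fun w => Rabs (z w))) in *.
  pose proof (Ex_abs_sq_le_hsq D q z Hq H1 H0 Hz) as HX; fold X in HX.
  assert (Hh : 0 <= hsq D q z).
  { apply Ex_nonneg; auto; intros w Hw Hp; specialize (Hz w Hw Hp).
    apply Rmult_le_pos; [apply Rle_0_sqr|left; apply Rinv_0_lt_compat; lra]. }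
  assert (HzS : forall w, (w < D)%nat -> 0 < q w -> z w <= INR s).
  { intros w Hw Hp; apply Rle_trans with (Rabs (z w)); [apply Rle_abs|].
    apply Rabs_le_of_sq; [lra|]; apply Rle_trans with (INR s); [|nra].
    apply Rmult_le_reg_l with (INR n); auto.
    assert (Ha : z w * z w <= (K * X) * (K * X)).
    { rewrite <- (Rabs_right (z w * z w)) by apply Rle_ge, Rle_0_sqr; rewrite Rabs_mult.
      pose proof (Rabs_pos (z w)); specialize (Hsup w Hw Hp); nra. }
    assert (Hb : (K * X) * (K * X) <= (K * K) * (2 * hsq D q z)).
    { replace (K * X * (K * X)) with (K * K * (X * X)) by ring.
      apply Rmult_le_compat_l; [apply Rle_0_sqr|auto]. }
    assert (Hc : INR n * (z w * z w) <= INR n * (K * K * (2 * hsq D q z)))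
      by (apply Rmult_le_compat_l; lra).
    assert (Hd : K * K * 2 * (INR n * hsq D q z) <= K * K * 2 * (C * INR s * L)).
    { apply Rmult_le_compat_l; [assert (0 <= K * K) by apply Rle_0_sqr; lra|auto]. }
    assert (He : INR s * (2 * C * (K * K) * L) <= INR s * INR n)
      by (apply Rmult_le_compat_l; lra).
    lra. }
  assert (HE : Ex D q (fun w => z w * z w) <= (2 + INR s) * hsq D q z).
  { unfold hsq; rewrite <- Ex_scal; apply Ex_le; auto; intros w Hw Hp.
    specialize (Hz w Hw Hp); specialize (HzS w Hw Hp).
    assert (0 <= z w * z w) by apply Rle_0_sqr.
    apply Rmult_le_reg_r with (2 + z w); [lra|].
    replace ((2 + INR s) * (z w * z w / (2 + z w)) * (2 + z w))
      with ((z w * z w) * (2 + INR s)) by (field; lra).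
    apply Rmult_le_compat_l; lra. }
  assert (INR n * Ex D q (fun w => z w * z w) <= (2 + INR s) * (INR n * hsq D q z)) by nra.
  assert (0 <= INR n * hsq D q z) by nra.
  nra.
Qed.

(** The step [delta] balances three errors: the pointwise change is at most
    [s delta K = K / sqrt n <= / 2], the squared L2 change times [n] is at most [n s delta^2 = / s],
    and the second-order loss is at most [16 delta^2 n s L = 16 L / s]. *)
Lemma lattice_witness (D n m s N : nat) (q : nat -> R) (K L delta : R)
  (e : nat -> nat -> R) (c : nat -> R) (d : list nat) :
  (forall w, (w < D)%nat -> 0 <= q w) -> rsum D q = 1 ->
  (forall j, (j < m)%nat -> forall w, (w < D)%nat -> 0 < q w ->
     Rabs (e j w) <= K * Ex D q (fun w => Rabs (e j w))) ->
  orthonormal D q m e -> (m <= s)%nat -> (1 <= s)%nat -> 0 < INR n -> 0 <= K ->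
  4 * (K * K) <= INR n -> 0 <= L -> delta = / (INR s * sqrt (INR n)) ->
  (forall w, (w < D)%nat -> 0 < q w -> -1 <= lincomb m e c w) ->
  valid_doc q D n d -> 0 <= dsum (fun w => psi (lincomb m e c w)) d ->
  (forall j, (j < m)%nat -> Rabs (c j) < delta * INR N) ->
  rsum m (fun j => dsum (fun w => e j w * e j w) d) <= INR n * INR s * L ->
  exists c', (forall j, (j < m)%nat -> In (c' j) (grid delta N)) /\
    (forall w, (w < D)%nat -> 0 < q w -> / 2 <= 2 + lincomb m e c' w) /\
    INR n * hsq D q (lincomb m e c) <= 3 * (INR n * hsq D q (lincomb m e c')) + 2 /\
    - (16 * L) <= dsum (fun w => psi (lincomb m e c' w)) d.
Proof.
  intros Hq H1 Hsup He Hms Hs Hn HK HKn HL Hdelta Hz [Hlen Hd] Hpsi Hc HX.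
  assert (Hs1 : 1 <= INR s) by (change 1 with (INR 1); apply le_INR; lia).
  assert (Hms' : INR m <= INR s) by now apply le_INR.
  pose proof (sqrt_lt_R0 _ Hn) as Hr; set (r := sqrt (INR n)) in *.
  assert (Hrr : r * r = INR n) by (apply sqrt_sqrt; lra).
  assert (Hd0 : 0 < delta).
  { rewrite Hdelta; apply Rinv_0_lt_compat, Rmult_lt_0_compat; lra. }
  assert (Hds : delta * INR s * r = 1) by (rewrite Hdelta; field; lra).
  assert (HKr : 2 * K <= r) by nra.
  assert (Hdsn : INR n * (delta * delta) * (INR s * INR s) = 1).
  { rewrite <- Hrr.
    replace (r * r * (delta * delta) * (INR s * INR s))
      with (delta * INR s * r * (delta * INR s * r)) by ring.
    rewrite Hds; ring. }
  (* [E|e_j| <= (1 + E e_j^2) / 2 = 1] for a normalised basis vector. *)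
  assert (Hej : forall j, (j < m)%nat -> forall w, (w < D)%nat -> 0 < q w -> Rabs (e j w) <= K).
  { intros j Hj w Hw Hp; eapply Rle_trans; [now apply Hsup|].
    rewrite <- (Rmult_1_r K) at 2; apply Rmult_le_compat_l; auto.
    apply Rle_trans with (Ex D q (fun w => / 2 + / 2 * (e j w * e j w))).
    - apply Ex_le; auto; intros u _ _.
      assert (Ha : Rabs (e j u) * Rabs (e j u) = e j u * e j u)
        by (rewrite <- Rabs_mult; apply Rabs_right, Rle_ge, Rle_0_sqr).
      assert (0 <= (Rabs (e j u) - 1) * (Rabs (e j u) - 1)) by apply Rle_0_sqr.
      nra.
    - rewrite Ex_plus, Ex_const, Ex_scal, He, Nat.eqb_refl by auto; lra. }
  assert (Hdiff : forall c' w, lincomb m e c' w - lincomb m e c w =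
      lincomb m e (fun j => c' j - c j) w).
  { intros; unfold lincomb; rewrite <- rsum_minus; apply rsum_ext; intros; ring. }
  assert (Hnear : forall c', (forall j, (j < m)%nat -> Rabs (c' j - c j) <= delta) ->
    forall w, (w < D)%nat -> 0 < q w -> Rabs (lincomb m e c' w - lincomb m e c w) <= / 2).
  { intros c' Hc' w Hw Hp; rewrite Hdiff.
    eapply Rle_trans; [apply Rabs_rsum|].
    apply Rle_trans with (rsum m (fun _ => delta * K)).
    - apply rsum_le; intros j Hj; rewrite Rabs_mult.
      apply Rmult_le_compat; auto; apply Rabs_pos.
    - rewrite rsum_const.
      assert (0 <= delta * K) by (apply Rmult_le_pos; lra).
      apply Rle_trans with (INR s * (delta * K)); [apply Rmult_le_compat_r; auto|].
      assert (0 < delta * INR s) by (apply Rmult_lt_0_compat; lra).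
      assert (delta * INR s * (2 * K) <= delta * INR s * r)
        by (apply Rmult_le_compat_l; lra).
      lra. }
  destruct (round_coeffs d m e c delta N Hd0 Hc) with (i := m)
    as (c' & Hc'1 & Hc'2 & _ & Hc'4); auto.
  { intros c' Hc' w Hw; destruct (Hd w Hw) as [Hw1 Hw2].
    pose proof (Rabs_le_inv _ _ (Hnear c' Hc' w Hw1 Hw2)); specialize (Hz w Hw1 Hw2); lra. }
  exists c'; split; [auto|split; [|split]].
  - intros w Hw Hp; pose proof (Rabs_le_inv _ _ (Hnear c' Hc'1 w Hw Hp));
      specialize (Hz w Hw Hp); lra.
  - assert (Hpert : hsq D q (lincomb m e c) <= 3 * hsq D q (lincomb m e c') +
       2 * Ex D q (fun w => (lincomb m e c' w - lincomb m e c w) *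
                            (lincomb m e c' w - lincomb m e c w))).
    { apply hsq_perturb; auto. }
    (* Parseval reduces the L2 change to the sum of at most [s] squared coordinate changes. *)
    rewrite (Ex_ext D q _ (fun w => lincomb m e (fun j => c' j - c j) w *
      lincomb m e (fun j => c' j - c j) w)), parseval in Hpert
      by (auto; intros; now rewrite Hdiff).
    assert (Hpar : rsum m (fun j => (c' j - c j) * (c' j - c j)) <= INR s * (delta * delta)).
    { apply Rle_trans with (rsum m (fun _ => delta * delta)).
      - apply rsum_le; intros j Hj; pose proof (Rabs_le_inv _ _ (Hc'1 j Hj)); nra.
      - rewrite rsum_const; apply Rmult_le_compat_r; [apply Rle_0_sqr|auto]. }
    assert (Hone : INR n * (INR s * (delta * delta)) <= 1).
    { rewrite <- Hdsn. assert (0 <= INR n * (delta * delta)) by nra. nra. }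
    nra.
  - assert (Hl : 16 * (delta * delta) * rsum m (fun j => dsum (fun w => e j w * e j w) d) <=
      16 * (delta * delta) * (INR n * INR s * L)).
    { apply Rmult_le_compat_l; auto; assert (0 < delta * delta) by nra; lra. }
    assert (Hll : delta * delta * (INR n * INR s * L) <= L).
    { assert (0 <= INR n * (delta * delta)) by nra.
      assert (INR n * (delta * delta) * INR s <= 1) by nra. nra. }
    lra.
Qed.

(** * Concentration *)

Lemma ln_ge_1 (x : R) : 3 <= x -> 1 <= ln x.
Proof.
  intros Hx; destruct (Rle_dec 1 (ln x)) as [|H]; auto.
  assert (Hlt : exp (ln x) < exp 1) by (apply exp_increasing; lra).
  rewrite exp_ln in Hlt by lra; pose proof exp_le_3; lra.
Qed.

Lemma ln_le_self (x : R) : 0 < x -> ln x <= x - 1.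
Proof. intros Hx; pose proof (exp_ineq1_le (ln x)) as H; rewrite exp_ln in H by auto; lra. Qed.

(** Lets [filter] select by an arbitrary proposition. *)
Definition decide (P : Prop) : bool := if excluded_middle_informative P then true else false.

Lemma decide_true (P : Prop) : decide P = true <-> P.
Proof. unfold decide; destruct (excluded_middle_informative P); split; auto; discriminate. Qed.

Lemma grid_length (delta : R) (N : nat) : length (grid delta N) = (2 * N + 1)%nat.
Proof. unfold grid; now rewrite length_map, length_seq. Qed.

Lemma expE_dprod_exp_psi (D n : nat) (q z : nat -> R) :
  (forall w, (w < D)%nat -> 0 <= q w) -> rsum D q = 1 -> Ex D q z = 0 ->
  (forall w, (w < D)%nat -> 0 < q w -> / 2 <= 2 + z w) ->
  expE q D n (dprod (fun w => exp (/ 16 * psi (z w)))) <=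
  exp (- (/ 64 * (INR n * hsq D q z))).
Proof.
  intros Hq H1 H0 Hz; rewrite expE_dprod.
  replace (- (/ 64 * (INR n * hsq D q z))) with (INR n * - (/ 64 * hsq D q z)) by ring.
  rewrite <- exp_pow_INR; apply pow_incr; split; [|now apply Ex_exp_psi].
  apply Ex_nonneg; auto; intros; left; apply exp_pos.
Qed.

(** [2 k^3 + 3 <= k^4] for [k >= 4], so there are at most [k^(4 s)] points. *)
Lemma net_cardinal_bound (k m s : nat) :
  (m <= s)%nat -> 4 <= INR k ->
  INR ((2 * (k ^ 3 + 1) + 1) ^ m) <= exp (4 * (INR s * ln (INR k))).
Proof.
  intros Hms Hk.
  assert (Hk4 : (4 <= k)%nat) by (apply INR_le; simpl; lra).
  assert (Hpow : ((2 * (k ^ 3 + 1) + 1) ^ m <= k ^ (4 * s))%nat).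
  { rewrite Nat.pow_mul_r; apply Nat.le_trans with ((k ^ 4) ^ m)%nat.
    - apply Nat.pow_le_mono_l; simpl; nia.
    - apply Nat.pow_le_mono_r; [apply Nat.pow_nonzero; lia|auto]. }
  apply le_INR in Hpow; eapply Rle_trans; [exact Hpow|].
  rewrite pow_INR, <- (exp_ln (INR k)) at 1 by lra.
  rewrite exp_pow_INR, mult_INR; apply Req_le; f_equal; simpl; ring.
Qed.

(* In the application [lincomb k b v w] is the relative density [inner k A w x / q w - 1].
   The constant [13824 = 6 * 36 * 64]: rounding keeps [n * hsq >= lam / 36], so a lattice
   point survives with probability [exp (- lam / 2304) = exp (- 6 s ln k)], against
   [exp (4 s ln k)] lattice points.  [41472 = 3 * 13824] bounds the coordinates by [k^3]. *)
Lemma likelihood_concentration (D k n : nat) (q : nat -> R) (K : R)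
  (V : (nat -> R) -> Prop) (U : nat -> bool) (b : nat -> nat -> R) :
  let s := length (filter U (seq 0 k)) in
  (forall w, (w < D)%nat -> 0 <= q w) -> rsum D q = 1 ->
  V (fun _ => 0) -> (forall x y a, V x -> V y -> V (fun w => x w + a * y w)) ->
  (forall i, (i < k)%nat -> V (b i)) -> (forall i w, U i = false -> b i w = 0) ->
  (forall z, V z -> Ex D q z = 0) ->
  (forall z, V z -> forall w, (w < D)%nat -> 0 < q w ->
     Rabs (z w) <= K * Ex D q (fun w => Rabs (z w))) ->
  (1 <= s)%nat -> 41472 <= INR k -> 0 < INR n -> 0 <= K ->
  2 * 13824 * (K * K) * ln (INR k) <= INR n ->
  1 - 2 / ln (INR k) <=
  expE q D n (fun d => indicator (forall v,
    (forall w, (w < D)%nat -> 0 < q w -> -1 <= lincomb k b v w) ->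
    (forall a, 0 <= a <= 1 -> 0 <= dsum (fun w => psi (a * lincomb k b v w)) d) ->
    INR n * hsq D q (lincomb k b v) <= 13824 * INR s * ln (INR k))).
Proof.
  intros s Hq H1 HV0 HVc Hb HU HVmean HVsup Hs Hk Hn HK HKn.
  set (L := ln (INR k)) in *.
  assert (HL : 1 <= L) by (apply ln_ge_1; lra).
  assert (HLk : L <= INR k) by (pose proof (ln_le_self (INR k)); unfold L; lra).
  assert (Hs1 : 1 <= INR s) by (change 1 with (INR 1); apply le_INR; lia).
  assert (Hsk : INR s <= INR k).
  { apply le_INR; unfold s; pose proof (filter_length_le U (seq 0 k)) as H.
    now rewrite length_seq in H. }
  destruct (gram_schmidt D k q V U b) as (m & e & Hm & HVe & He & Hspan); auto.
  fold s in Hm.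
  assert (Hms : INR m <= INR s) by now apply le_INR.
  assert (HVlin : forall c, V (lincomb m e c)) by (intros; now apply lincomb_closed).
  (* The coordinates are at most [k^3] in units of [delta]; the extra 1 gives the strict bound that
     rounding requires. *)
  set (N := (k ^ 3 + 1)%nat).
  set (delta := / (INR s * sqrt (INR n))).
  set (lam := 13824 * INR s * L).
  assert (Hlam : 13824 <= lam) by (unfold lam; nra).
  destruct (coef_net m (grid delta N)) as (Net0 & Hlen0 & HNet0).
  (* The union bound runs only over lattice points where the exponential estimate applies and the
     distance is still large. *)
  set (ok := fun c => (forall w, (w < D)%nat -> 0 < q w -> / 2 <= 2 + lincomb m e c w) /\
                      lam / 36 <= INR n * hsq D q (lincomb m e c)).
  set (Net := filter (fun c => decide (ok c)) Net0).
  (* Two nonnegative variables of mean at most [/ L], scaled so that a bad document forces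
     [X1 + X2 >= 1]: [X1] measures the rounding loss against its threshold, [X2] adds up the
     exponential weights of the net. *)
  set (X1 := fun d => / (INR n * INR s * L) *
                      rsum m (fun j => dsum (fun w => e j w * e j w) d)).
  set (X2 := fun d => exp L * lsum Net
    (fun c => dprod (fun w => exp (/ 16 * psi (lincomb m e c w))) d)).
  assert (HnsL : 0 < INR n * INR s * L) by (apply Rmult_lt_0_compat; nra).
  assert (EX1 : expE q D n X1 <= / L).
  { unfold X1; rewrite expE_scal, expE_rsum by auto.
    rewrite (rsum_ext m _ (fun _ => INR n)).
    - rewrite rsum_const. apply Rmult_le_reg_l with (INR n * INR s * L); auto.
      rewrite <- Rmult_assoc, Rinv_r, Rmult_1_l by lra.
      replace (INR n * INR s * L * / L) with (INR s * INR n) by (field; lra).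
      apply Rmult_le_compat_r; lra.
    - intros j Hj.
      transitivity (expE q D n (dsum (fun w => e j w * e j w))); [reflexivity|].
      rewrite expE_dsum, He, Nat.eqb_refl by auto; ring. }
  assert (EX2 : expE q D n X2 <= / L).
  { unfold X2; rewrite expE_scal, expE_lsum by auto.
    apply Rle_trans with (exp L * (exp (4 * (INR s * L)) * exp (- (lam / 2304)))).
    - apply Rmult_le_compat_l; [left; apply exp_pos|].
      eapply Rle_trans; [apply lsum_le_const with (a := exp (- (lam / 2304)))|].
      + intros c Hc; apply filter_In in Hc; destruct Hc as [_ Hc].
        apply (proj1 (decide_true _)) in Hc; destruct Hc as [Hc1 Hc2].
        eapply Rle_trans; [apply (expE_dprod_exp_psi D n q (lincomb m e c)); auto|].
        assert (Hle : - (/ 64 * (INR n * hsq D q (lincomb m e c))) <= - (lam / 2304)) by lra.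
        destruct Hle as [Hlt|Heq]; [left; now apply exp_increasing|rewrite Heq; lra].
      + apply Rmult_le_compat_r; [left; apply exp_pos|].
        apply Rle_trans with (INR (length Net0)); [apply le_INR, filter_length_le|].
        rewrite Hlen0, grid_length; unfold N, L; apply net_cardinal_bound; [auto|lra].
    - rewrite <- !exp_plus.
      (* [lam / 2304 = 6 s L], so the left side is [L - 2 s L]. *)
      assert (Hexp : L + (4 * (INR s * L) + - (lam / 2304)) <= - L) by (unfold lam; nra).
      apply Rle_trans with (exp (- L)).
      + destruct Hexp as [Hlt|Heq]; [left; now apply exp_increasing|rewrite Heq; lra].
      + rewrite exp_Ropp; unfold L at 1; rewrite exp_ln by lra.
        apply Rinv_le_contravar; lra. }
  (* Markov's inequality for both variables at once: the indicator is at least [1 - X1 - X2] on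
     every valid document. *)
  apply Rle_trans with (expE q D n (fun d => 1 + (-1 * X1 d + -1 * X2 d))).
  { rewrite expE_plus, expE_const, expE_plus, !expE_scal by auto.
    unfold Rdiv; lra. }
  apply expE_le; auto; intros d Hd.
  assert (HX1 : 0 <= X1 d).
  { unfold X1; apply Rmult_le_pos; [left; now apply Rinv_0_lt_compat|].
    apply rsum_nonneg; intros; apply dsum_nonneg; intros; apply Rle_0_sqr. }
  assert (Hterm : forall c : nat -> R,
    0 <= dprod (fun w => exp (/ 16 * psi (lincomb m e c w))) d)
    by (intros; rewrite dprod_exp; left; apply exp_pos).
  assert (HX2 : 0 <= X2 d).
  { unfold X2; apply Rmult_le_pos; [left; apply exp_pos|now apply lsum_nonneg]. }
  unfold indicator; destruct (excluded_middle_informative _) as [|Hbad]; [lra|].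
  destruct (Rle_dec 1 (X1 d + X2 d)) as [|Hsmall]; [lra|].
  exfalso; apply Hbad; intros v Hv Hlik.
  destruct (Rle_dec (INR n * hsq D q (lincomb k b v)) lam) as [|Hgt]; auto; exfalso.
  destruct (exists_scale D n q (lincomb k b v) lam) as (a & Ha & Hahi); auto; [lra|].
  destruct (lincomb_span D k m q b e (fun i => a * v i) Hspan) as [c Hc].
  assert (Hca : forall w, (w < D)%nat -> 0 < q w -> lincomb m e c w = a * lincomb k b v w).
  { intros w Hw Hp; rewrite <- Hc by auto; apply lincomb_scal. }
  assert (Hhc : hsq D q (lincomb m e c) = hsq D q (fun w => a * lincomb k b v w)).
  { unfold hsq; apply Ex_ext; auto; intros w Hw Hp; now rewrite Hca. }
  assert (Hcge : forall w, (w < D)%nat -> 0 < q w -> -1 <= lincomb m e c w).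
  { intros w Hw Hp; rewrite Hca by auto; specialize (Hv w Hw Hp); nra. }
  assert (Hvar : INR n * rsum m (fun j => c j * c j) <= 3 * INR s * lam).
  { rewrite <- (parseval D q m e c He).
    apply (sup_and_variance_bound D n s q (lincomb m e c) K L 13824); auto.
    rewrite Hhc; unfold lam in Hahi; lra. }
  pose proof (sqrt_lt_R0 _ Hn) as Hr.
  assert (Hrr : sqrt (INR n) * sqrt (INR n) = INR n) by (apply sqrt_sqrt; lra).
  set (r := sqrt (INR n)) in *.
  assert (Hd0 : 0 < delta) by (apply Rinv_0_lt_compat, Rmult_lt_0_compat; lra).
  assert (HN : INR N = INR k ^ 3 + 1)
    by (unfold N; rewrite plus_INR, pow_INR; simpl; ring).
  assert (Hcsmall : forall j, (j < m)%nat -> Rabs (c j) < delta * INR N).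
  { intros j Hj.
    assert (Hcj : c j * c j <= rsum m (fun j => c j * c j)).
    { apply (rsum_term_le m (fun j => c j * c j)); auto; intros; apply Rle_0_sqr. }
    (* Squared, this is [n c_j^2 s^2 <= 3 s lam s^2 = 41472 L s^4], and [41472 L <= k^2],
       [s^4 <= k^4]. *)
    assert (Hscaled : Rabs (c j * (INR s * r)) <= INR k ^ 3).
    { apply Rabs_le_of_sq; [apply pow_le; lra|].
      replace (c j * (INR s * r) * (c j * (INR s * r)))
        with (INR n * (c j * c j) * (INR s * INR s)) by (rewrite <- Hrr; ring).
      assert (Hss : 0 <= INR s * INR s) by nra.
      apply Rle_trans with (3 * INR s * lam * (INR s * INR s)).
      - apply Rmult_le_compat_r; auto.
        apply Rle_trans with (INR n * rsum m (fun j => c j * c j)); auto.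
        apply Rmult_le_compat_l; lra.
      - replace (3 * INR s * lam * (INR s * INR s))
          with (41472 * L * ((INR s * INR s) * (INR s * INR s))) by (unfold lam; ring).
        replace (INR k ^ 3 * INR k ^ 3)
          with (INR k * INR k * ((INR k * INR k) * (INR k * INR k))) by ring.
        assert (Hssk : INR s * INR s <= INR k * INR k) by nra.
        apply Rmult_le_compat; [nra|nra| |nra].
        apply Rmult_le_compat; lra. }
    replace (c j) with (delta * (c j * (INR s * r))) by (unfold delta; field; lra).
    rewrite Rabs_mult, (Rabs_right delta) by lra.
    apply Rmult_lt_compat_l; lra. }
  destruct (lattice_witness D n m s N q K L delta e c d) as (c' & Hgrid & Hlow & Hhsq & Hpsi);
    auto; try lra.
  - nra.
  - rewrite (dsum_ext _ (fun w => psi (a * lincomb k b v w))); [now apply Hlik|].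
    destruct Hd as [_ Hd]; intros w Hw; destruct (Hd w Hw); now rewrite Hca.
  - apply Rmult_le_reg_l with (/ (INR n * INR s * L)); [now apply Rinv_0_lt_compat|].
    rewrite Rinv_l by lra; fold (X1 d); lra.
  - destruct (HNet0 c' Hgrid) as (c'' & Hin & Heq).
    assert (Hlin : forall w, lincomb m e c'' w = lincomb m e c' w)
      by (intros; now apply lincomb_ext).
    assert (Hin' : In c'' Net).
    { apply filter_In; split; auto; apply (proj2 (decide_true _)); split.
      - intros w Hw Hp; rewrite Hlin; auto.
      (* From [lam / 6 <= 3 n hsq + 2], the rounded point keeps [(lam / 6 - 2) / 3 >= lam / 36]. *)
      - replace (hsq D q (lincomb m e c'')) with (hsq D q (lincomb m e c'));
          [rewrite Hhc in Hhsq; lra|].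
        unfold hsq, Ex; apply rsum_ext; intros; now rewrite Hlin. }
    pose proof (lsum_term_le Net _ c'' Hterm Hin') as Hge; cbv beta in Hge.
    rewrite dprod_exp, dsum_scal, (dsum_ext _ (fun w => psi (lincomb m e c' w))) in Hge
      by (intros; now rewrite Hlin).
    (* The rounded sum of [psi] is at least [- 16 L], so this single lattice point already makes
       [X2] reach 1. *)
    assert (Hge1 : exp (- L) <= exp (/ 16 * dsum (fun w => psi (lincomb m e c' w)) d)).
    { assert (Hle : - L <= / 16 * dsum (fun w => psi (lincomb m e c' w)) d) by lra.
      destruct Hle as [Hlt|Heq']; [left; now apply exp_increasing|rewrite Heq'; lra]. }
    assert (HX2' : exp L * exp (- L) <= X2 d).
    { unfold X2; apply Rmult_le_compat_l; [left; apply exp_pos|lra]. }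
    rewrite <- exp_plus, Rplus_opp_r, exp_0 in HX2'; lra.
Qed.

(** * Existence of the maximum likelihood estimator *)

Lemma increasing_ge (phi : nat -> nat) :
  (forall n, (phi n < phi (S n))%nat) -> forall n, (n <= phi n)%nat.
Proof. intros H n; induction n as [|n IH]; [lia|specialize (H n); lia]. Qed.

Lemma Un_cv_subseq (u : nat -> R) (l : R) (phi : nat -> nat) :
  (forall n, (phi n < phi (S n))%nat) -> Un_cv u l -> Un_cv (fun n => u (phi n)) l.
Proof.
  intros Hphi Hu eps Heps; destruct (Hu eps Heps) as [N HN]; exists N; intros n Hn.
  apply HN; pose proof (increasing_ge phi Hphi n); lia.
Qed.

Lemma Un_cv_ext (u v : nat -> R) (l : R) : (forall n, u n = v n) -> Un_cv u l -> Un_cv v l.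
Proof.
  intros H Hu eps Heps; destruct (Hu eps Heps) as [N HN]; exists N; intros n Hn.
  rewrite <- H; auto.
Qed.

Lemma Un_cv_const (a : R) : Un_cv (fun _ => a) a.
Proof.
  intros eps Heps; exists O; intros; unfold R_dist, Rdist; rewrite Rminus_diag, Rabs_R0; auto.
Qed.

Lemma Un_cv_ge_limit (u : nat -> R) (l M : R) : Un_cv u l -> (forall n, M <= u n) -> M <= l.
Proof.
  intros Hu H; destruct (Rle_dec M l) as [|Hgt]; auto.
  destruct (Hu (M - l)) as [N HN]; [lra|]; specialize (HN N (le_n N)); specialize (H N).
  unfold R_dist, Rdist in HN; apply Rabs_def2 in HN; lra.
Qed.

(** Bolzano-Weierstrass gives a cluster point [l]; choice gives [g (N, i)], an index at least [N]
    whose value is within [/ (i + 1)] of [l]. Iterating from [S (phi m)] makes [phi] strictly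
    increasing. *)
Lemma bounded_subseq1 (u : nat -> R) :
  (forall n, 0 <= u n <= 1) ->
  exists phi l, (forall n, (phi n < phi (S n))%nat) /\ Un_cv (fun n => u (phi n)) l.
Proof.
  intros Hu.
  destruct (Bolzano_Weierstrass u (fun c => 0 <= c <= 1) (compact_P3 0 1) Hu) as [l Hl].
  assert (Hclose : forall p : nat * nat, exists j,
    (fst p <= j)%nat /\ Rabs (u j - l) < / (INR (snd p) + 1)).
  { intros [N i]; simpl; pose proof (pos_INR i) as Hi.
    assert (Hpos : 0 < / (INR i + 1)) by (apply Rinv_0_lt_compat; lra).
    apply (Hl (fun x => Rabs (x - l) < / (INR i + 1)) N).
    exists (mkposreal _ Hpos); intros x Hx; exact Hx. }
  destruct (choice _ Hclose) as [g Hg].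
  set (phi := fix phi n := match n with O => g (O, O) | S m => g (S (phi m), S m) end).
  exists phi, l; split.
  - intros n; simpl; destruct (Hg (S (phi n), S n)) as [H _]; simpl in H; lia.
  - intros eps Heps; destruct (archimed_cor1 eps Heps) as (N & HN & HN0).
    exists N; intros n Hn.
    assert (Hclose' : Rabs (u (phi n) - l) < / (INR n + 1)).
    { destruct n as [|n]; simpl phi;
        [exact (proj2 (Hg (O, O)))|exact (proj2 (Hg (S (phi n), S n)))]. }
    apply lt_0_INR in HN0; apply le_INR in Hn.
    assert (/ (INR n + 1) <= / INR N) by (apply Rinv_le_contravar; lra).
    unfold R_dist, Rdist; lra.
Qed.

Lemma bounded_subseq (k : nat) (u : nat -> nat -> R) :
  (forall n i, (i < k)%nat -> 0 <= u n i <= 1) ->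
  exists phi l, (forall n, (phi n < phi (S n))%nat) /\
    forall i, (i < k)%nat -> Un_cv (fun n => u (phi n) i) (l i).
Proof.
  induction k as [|k IH]; intros Hu.
  - exists (fun n => n), (fun _ => 0); split; intros; lia.
  - destruct IH as (phi & l & Hphi & Hl); auto.
    destruct (bounded_subseq1 (fun n => u (phi n) k)) as (phi' & lk & Hphi' & Hlk); auto.
    exists (fun n => phi (phi' n)), (extend k l lk); split.
    + intros n; specialize (Hphi' n).
      assert (Hmono : forall a b, (a < b)%nat -> (phi a < phi b)%nat).
      { intros a b Hab; induction Hab as [|b Hab IHab]; [apply Hphi|].
        specialize (Hphi b); lia. }
      auto.
    + intros i Hi; destruct (Nat.eq_dec i k) as [->|].
      * now rewrite extend_eq.
      * rewrite extend_lt by lia; apply (Un_cv_subseq (fun n => u (phi n) i)); auto.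
        apply Hl; lia.
Qed.

(** A maximising sequence has a convergent subsequence. Points are functions on all of [nat] with
    only [k] coordinates controlled, so closedness asks for some point of [X] realising the limit of
    [F], not for [l] itself. *)
Lemma exists_maximizer (k : nat) (X : (nat -> R) -> Prop) (F : (nat -> R) -> R)
  (M : R) (x0 : nat -> R) :
  X x0 -> (forall x, X x -> F x <= M) ->
  (forall x i, X x -> (i < k)%nat -> 0 <= x i <= 1) ->
  (forall (u : nat -> nat -> R) l, (forall n, X (u n)) ->
     (forall i, (i < k)%nat -> Un_cv (fun n => u n i) (l i)) ->
     exists x, X x /\ Un_cv (fun n => F (u n)) (F x)) ->
  exists x, X x /\ forall y, X y -> F y <= F x.
Proof.
  intros Hx0 HM Hbox Hclosed.
  destruct (completeness (fun y => exists x, X x /\ y = F x)) as [S [HS1 HS2]].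
  - exists M; intros y (x & Hx & ->); auto.
  - now exists (F x0), x0.
  - assert (Happrox : forall n : nat, exists x, X x /\ S - / (INR n + 1) < F x).
    { intros n; destruct (classic (exists x, X x /\ S - / (INR n + 1) < F x)) as [|Hno]; auto.
      exfalso; assert (Hpos : 0 < / (INR n + 1))
        by (apply Rinv_0_lt_compat; pose proof (pos_INR n); lra).
      assert (S <= S - / (INR n + 1)); [|lra].
      apply HS2; intros y (x & Hx & ->).
      destruct (Rle_dec (F x) (S - / (INR n + 1))) as [|Hgt]; auto.
      exfalso; apply Hno; exists x; split; auto; lra. }
    destruct (choice _ Happrox) as [u Hu].
    destruct (bounded_subseq k u) as (phi & l & Hphi & Hl).
    { intros n i Hi; apply Hbox; auto; apply Hu. }
    destruct (Hclosed (fun n => u (phi n)) l) as (x & Hx & Hcv); auto.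
    { intros n; apply Hu. }
    exists x; split; auto; intros y Hy.
    apply Rle_trans with S; [apply HS1; now exists y|].
    destruct (Rle_dec S (F x)) as [|Hgt]; auto; exfalso.
    destruct (Hcv ((S - F x) / 2)) as [N1 HN1]; [lra|].
    destruct (archimed_cor1 ((S - F x) / 2)) as (N2 & HN2 & HN2p); [lra|].
    set (n := max N1 N2).
    specialize (HN1 n ltac:(lia)); unfold R_dist, Rdist in HN1; apply Rabs_def2 in HN1.
    destruct (Hu (phi n)) as [_ Hun].
    assert (HNn : INR N2 <= INR (phi n))
      by (apply le_INR; pose proof (increasing_ge phi Hphi n); lia).
    apply lt_0_INR in HN2p.
    assert (/ (INR (phi n) + 1) <= / INR N2) by (apply Rinv_le_contravar; lra).
    lra.
Qed.

(** * Continuity and positivity of the likelihood *)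

Lemma Un_cv_rsum (k : nat) (u : nat -> nat -> R) (l : nat -> R) :
  (forall i, (i < k)%nat -> Un_cv (fun n => u n i) (l i)) ->
  Un_cv (fun n => rsum k (u n)) (rsum k l).
Proof.
  induction k as [|k IH]; intros H; simpl; [apply Un_cv_const|].
  apply (CV_plus (fun n => rsum k (u n)) (fun n => u n k)); auto.
Qed.

Lemma Un_cv_inner (k : nat) (A : nat -> nat -> R) (w : nat) (u : nat -> nat -> R)
  (l : nat -> R) :
  (forall i, (i < k)%nat -> Un_cv (fun n => u n i) (l i)) ->
  Un_cv (fun n => inner k A w (u n)) (inner k A w l).
Proof.
  intros H; apply (Un_cv_rsum k (fun n i => A w i * u n i) (fun i => A w i * l i)).
  intros i Hi; apply (CV_mult (fun _ => A w i)); auto; apply Un_cv_const.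
Qed.

Lemma Un_cv_dprod (d : list nat) (f : nat -> nat -> R) (g : nat -> R) :
  (forall w, Un_cv (fun n => f n w) (g w)) -> Un_cv (fun n => dprod (f n) d) (dprod g d).
Proof.
  intros H; induction d as [|w d IH]; [exact (Un_cv_const 1)|].
  apply (CV_mult (fun n => f n w) (fun n => dprod (f n) d)); auto.
Qed.

Lemma dprod_bounds (f : nat -> R) (d : list nat) :
  (forall w, In w d -> 0 <= f w <= 1) -> 0 <= dprod f d <= 1.
Proof.
  induction d as [|w d IH]; intros H; [unfold dprod; simpl; lra|].
  change (dprod f (w :: d)) with (f w * dprod f d).
  assert (0 <= f w <= 1) by (apply H; now left).
  assert (0 <= dprod f d <= 1) by (apply IH; intros; apply H; now right). nra.
Qed.

Lemma dprod_pos (f : nat -> R) (d : list nat) :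
  (forall w, In w d -> 0 < f w) -> 0 < dprod f d.
Proof.
  induction d as [|w d IH]; intros H; [unfold dprod; simpl; lra|].
  change (dprod f (w :: d)) with (f w * dprod f d).
  apply Rmult_lt_0_compat; [apply H; now left|apply IH; intros; apply H; now right].
Qed.

Lemma dprod_pos_inv (f : nat -> R) (d : list nat) (w : nat) :
  (forall w, In w d -> 0 <= f w) -> 0 < dprod f d -> In w d -> 0 < f w.
Proof.
  induction d as [|u d IH]; intros Hf Hp Hw; [destruct Hw|].
  change (dprod f (u :: d)) with (f u * dprod f d) in Hp.
  assert (Hu : 0 <= f u) by (apply Hf; now left).
  assert (Hd : 0 <= dprod f d).
  { clear - Hf; induction d as [|v d IH]; [unfold dprod; simpl; lra|].
    change (dprod f (v :: d)) with (f v * dprod f d); apply Rmult_le_pos.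
    - apply Hf; right; now left.
    - apply IH; intros x [<-|Hx]; apply Hf; [now left|right; now right]. }
  destruct Hw as [<-|Hw]; [|apply IH; auto]; try (intros; apply Hf; now right).
  - destruct Hu as [|Hu]; auto; rewrite <- Hu in Hp; lra.
  - destruct Hd as [|Hd']; auto; rewrite <- Hd' in Hp; lra.
Qed.

Lemma loglik_dprod (k : nat) (A : nat -> nat -> R) (d : list nat) (x : nat -> R) :
  finite_lik k A d x -> loglik k A d x = ln (dprod (fun w => inner k A w x) d).
Proof.
  unfold loglik; induction d as [|w d IH]; intros H; [symmetry; apply ln_1|].
  simpl; rewrite IH by (intros u Hu; apply H; now right).
  symmetry; apply ln_mult; [apply H; now left|apply dprod_pos; intros; apply H; now right].
Qed.

Lemma inner_nonneg (k : nat) (A : nat -> nat -> R) (w : nat) (x : nat -> R) :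
  (forall i, (i < k)%nat -> 0 <= A w i) -> (forall i, (i < k)%nat -> 0 <= x i) ->
  0 <= inner k A w x.
Proof. intros; apply rsum_nonneg; intros; apply Rmult_le_pos; auto. Qed.

(** The product of the inner products is continuous on the whole compact set, with value 0 where the
    log-likelihood would be infinite. Its maximum is positive because it is positive at [xs], so the
    maximizer has finite log-likelihood and [ln] preserves the order. *)
Lemma MLE_exists (D k n : nat) (A : nat -> nat -> R) (xs : nat -> R) (d : list nat) :
  word_topic D k A -> in_simplex k xs -> valid_doc (word_dist k A xs) D n d ->
  exists x, is_MLE k A xs d x.
Proof.
  intros [HA HA1] [Hxs Hxs1] [_ Hd].
  set (F := fun x => dprod (fun w => inner k A w x) d).
  assert (Hxs' : in_DeltaR k xs xs).
  { split; [auto|split; [|auto]]; intros i Hi Hns.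
    destruct (Hxs i Hi) as [Hp|]; auto; exfalso; apply Hns; now split. }
  assert (Hbox : forall x i, in_DeltaR k xs x -> (i < k)%nat -> 0 <= x i <= 1).
  { intros x i (Hx & _ & Hx1) Hi; split; auto; rewrite <- Hx1; now apply rsum_term_le. }
  assert (Hinner : forall x w, in_DeltaR k xs x -> In w d -> 0 <= inner k A w x <= 1).
  { intros x w Hx Hw; destruct (Hd w Hw) as [HwD _]; destruct Hx as (Hx & Hx' & Hx1).
    split; [apply inner_nonneg; auto|].
    rewrite <- Hx1; apply rsum_le; intros i Hi; rewrite <- (Rmult_1_l (x i)) at 2.
    apply Rmult_le_compat_r; auto; rewrite <- (HA1 i Hi).
    apply (rsum_term_le D (fun w => A w i)); auto. }
  destruct (exists_maximizer k (in_DeltaR k xs) F 1 xs) as (x & Hx & Hmax); auto.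
  - intros x Hx; apply dprod_bounds; auto.
  - intros u l Hu Hl; exists (fun i => if Nat.ltb i k then l i else 0).
    assert (Hl' : forall i, (i < k)%nat ->
      Un_cv (fun n => u n i) (if Nat.ltb i k then l i else 0)).
    { intros i Hi; destruct (Nat.ltb_spec i k); [auto|lia]. }
    split; [split; [|split]|].
    + intros i Hi; apply (Un_cv_ge_limit (fun n => u n i)); auto.
      intros n'; now apply Hu.
    + intros i Hi Hns; apply (UL_sequence (fun n => u n i)); auto.
      apply Un_cv_ext with (fun _ => 0); [|apply Un_cv_const].
      intros n'; symmetry; now apply Hu.
    + apply (UL_sequence (fun n => rsum k (u n))); [now apply Un_cv_rsum|].
      apply Un_cv_ext with (fun _ => 1); [|apply Un_cv_const].
      intros n'; symmetry; now apply Hu.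
    + apply Un_cv_dprod; intros w; now apply Un_cv_inner.
  - assert (Hfin : finite_lik k A d x).
    { intros w Hw; apply (dprod_pos_inv (fun w => inner k A w x) d); auto.
      - intros u Hu; now apply Hinner.
      - eapply Rlt_le_trans; [|apply (Hmax xs Hxs')].
        apply dprod_pos; intros u Hu; now apply Hd. }
    exists x; split; [auto|split; [auto|]]; intros y Hy Hfy.
    rewrite !loglik_dprod by auto.
    assert (Hle : F y <= F x) by now apply Hmax.
    assert (0 < F y) by (apply dprod_pos; auto).
    destruct Hle as [Hlt|Heq]; [left; now apply ln_increasing|].
    unfold F in Heq; rewrite Heq; lra.
Qed.

(** * Risk of the maximum likelihood estimator *)

Lemma inner_lincomb (k : nat) (A : nat -> nat -> R) (w : nat) (a b : R) (x y : nat -> R) :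
  inner k A w (fun i => a * x i + b * y i) = a * inner k A w x + b * inner k A w y.
Proof.
  unfold inner; rewrite <- !rsum_scal, <- rsum_plus; apply rsum_ext; intros; ring.
Qed.

Lemma rsum_inner (D k : nat) (A : nat -> nat -> R) (v : nat -> R) :
  word_topic D k A -> rsum D (fun w => inner k A w v) = rsum k v.
Proof.
  intros [_ HA]; unfold inner; rewrite rsum_swap; apply rsum_ext; intros i Hi.
  rewrite (rsum_ext D _ (fun w => v i * A w i)) by (intros; ring).
  rewrite rsum_scal, HA by auto; ring.
Qed.

(* Compare the maximizer with the point at fraction [a/2] of the segment from [xs]. *)
Lemma MLE_psi_nonneg (D k n : nat) (A : nat -> nat -> R) (xs x z : nat -> R)
  (d : list nat) (a : R) :
  word_topic D k A -> in_simplex k xs -> valid_doc (word_dist k A xs) D n d ->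
  is_MLE k A xs d x ->
  (forall w, In w d -> z w = inner k A w x / word_dist k A xs w - 1) ->
  0 <= a <= 1 -> 0 <= dsum (fun w => psi (a * z w)) d.
Proof.
  intros [HA _] [Hxs Hxs1] [_ Hd] ((Hx0 & Hxns & Hx1) & Hfin & Hmax) Hz Ha.
  set (y := fun i => (1 - a / 2) * xs i + a / 2 * x i).
  assert (Hy : in_DeltaR k xs y).
  { split; [|split].
    - intros i Hi; specialize (Hxs i Hi); specialize (Hx0 i Hi); unfold y; nra.
    - intros i Hi Hns; unfold y; rewrite (Hxns i Hi Hns).
      destruct (Hxs i Hi) as [Hp|<-]; [exfalso; apply Hns; now split|ring].
    - unfold y; rewrite rsum_plus, !rsum_scal, Hxs1, Hx1; field. }
  assert (Hyin : forall w, inner k A w y =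
    (1 - a / 2) * word_dist k A xs w + a / 2 * inner k A w x)
    by (intros; apply inner_lincomb).
  assert (Hfy : finite_lik k A d y).
  { intros w Hw; rewrite Hyin; destruct (Hd w Hw) as [_ Hq]; specialize (Hfin w Hw); nra. }
  specialize (Hmax y Hy Hfy).
  assert (Hsum : a * (loglik k A d x - loglik k A d y) <=
                 (2 - a) * dsum (fun w => psi (a * z w)) d).
  { change (loglik k A d x) with (dsum (fun w => ln (inner k A w x)) d).
    change (loglik k A d y) with (dsum (fun w => ln (inner k A w y)) d).
    replace (dsum (fun w => ln (inner k A w x)) d - dsum (fun w => ln (inner k A w y)) d)
      with (dsum (fun w => ln (inner k A w x)) d + -1 * dsum (fun w => ln (inner k A w y)) d)
      by ring.
    rewrite <- (dsum_scal (-1)), <- dsum_plus, <- !dsum_scal; apply dsum_le; intros w Hw.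
    destruct (Hd w Hw) as [_ Hq]; pose proof (Hfin w Hw) as Hu; pose proof (Hfy w Hw) as Hv.
    rewrite Hz by auto; set (q := word_dist k A xs w) in *.
    specialize (Hyin w); fold q in Hyin.
    set (u := inner k A w x) in *; set (v := inner k A w y) in *.
    assert (Hln : ln u + -1 * ln v <= u / v - 1).
    { replace (ln u + -1 * ln v) with (ln (u / v)) 
        by (unfold Rdiv; rewrite ln_mult, ln_Rinv by (auto; now apply Rinv_0_lt_compat); ring).
      apply ln_le_self, Rdiv_lt_0_compat; auto. }
    (* With [z = u / q - 1] one has [v / q = 1 + a z / 2], and both sides equal
       [a (2 - a) z / (2 + a z)]; this is where [psi] comes from. *)
    assert (Heq : (2 - a) * psi (a * (u / q - 1)) = a * (u / v - 1)).
    { unfold psi; rewrite Hyin in *; field; repeat split; nra. }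
    rewrite Heq; apply Rmult_le_compat_l; lra. }
  assert (0 <= a * (loglik k A d x - loglik k A d y)) by (apply Rmult_le_pos; lra).
  destruct (Rle_dec 0 (dsum (fun w => psi (a * z w)) d)) as [|Hneg]; auto; nra.
Qed.

(** (A1) gives [A w i <= (r / tau) q w] on the support. Together with (A2), every relative density
    in the span is bounded by [K E|z|] with [K = kappa r / tau], so the condition on [n] is the one
    of the concentration bound. (A2) then passes from the error in [A x] to the error in [x]. *)
Lemma MLE_risk_bound (D k r n : nat) (tau kappa : R) (A : nat -> nat -> R) (xs : nat -> R) :
  word_topic D k A -> in_simplex k xs -> 0 < tau <= 1 -> 0 < kappa ->
  assumption_A1 k r tau xs -> assumption_A2 D k r kappa A ->
  2 * 13824 * kappa ^ 2 * INR r ^ 2 * ln (INR k) / tau ^ 2 <= INR n ->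
  41472 <= INR k ->
  1 - 2 / ln (INR k) <=
  probE (word_dist k A xs) D n
    (fun doc =>
       (exists x, is_MLE k A xs doc x) /\
       forall x, is_MLE k A xs doc x ->
         dist_Ax D k A x xs <= 2 * 13824 * ln (INR k) ^ 1 * sqrt (INR r / INR n) /\
         dist_x k x xs <= 2 * 13824 * ln (INR k) ^ 1 * kappa * sqrt (INR r / INR n)).
Proof.
  intros HA Hxs Htau Hkappa [(S & HSr & HS) Htr] HA2 Hn Hk.
  pose proof (conj HA Hxs) as [[HA0 HA1] [Hxs0 Hxs1]].
  set (q := word_dist k A xs) in *; set (L := ln (INR k)) in *.
  assert (HL : 1 <= L) by (apply ln_ge_1; lra).
  set (U := fun i => decide (in_supp k xs i)).
  assert (HUtrue : forall i, (i < k)%nat -> U i = true -> 0 < xs i).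
  { intros i Hi Hu; apply (proj1 (decide_true _)) in Hu; apply Hu. }
  assert (HUfalse : forall i, U i = false -> ~ in_supp k xs i).
  { intros i Hu Hsup; apply (proj2 (decide_true _)) in Hsup; unfold U in Hu; congruence. }
  assert (Hxs00 : forall i, (i < k)%nat -> U i = false -> xs i = 0).
  { intros i Hi Hu; destruct (Hxs0 i Hi) as [Hp|]; auto.
    exfalso; apply (HUfalse i Hu); now split. }
  set (supp := filter U (seq 0 k)).
  assert (Hsr : (length supp <= r)%nat).
  { apply Nat.le_trans with (length S); auto; apply NoDup_incl_length.
    - apply NoDup_filter, seq_NoDup.
    - intros i Hi; apply filter_In in Hi; destruct Hi as [Hi Hu]; apply in_seq in Hi.
      apply HS; [lia|]; specialize (HUtrue i ltac:(lia) Hu); lra. }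
  assert (Hs1 : (1 <= length supp)%nat).
  { destruct supp as [|i l] eqn:Es; [|simpl; lia]; exfalso.
    rewrite (rsum_ext k _ (fun _ => 0)), rsum_zero in Hxs1; [lra|].
    intros i Hi; apply Hxs00; auto; destruct (U i) eqn:Hu; auto.
    assert (Hin : In i supp) by (apply filter_In; split; [apply in_seq; lia|auto]).
    rewrite Es in Hin; destruct Hin. }
  assert (Hr1 : 1 <= INR r) by (change 1 with (INR 1); apply le_INR; lia).
  assert (Hsr' : INR (length supp) <= INR r) by now apply le_INR.
  set (K := kappa * (INR r / tau)).
  assert (Hrt : 0 < INR r / tau) by (apply Rdiv_lt_0_compat; lra).
  assert (HK : 0 < K) by now apply Rmult_lt_0_compat.
  assert (HKn : 2 * 13824 * (K * K) * L <= INR n).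
  { eapply Rle_trans; [|exact Hn]; apply Req_le; unfold K; field; lra. }
  assert (Hn0 : 0 < INR n).
  { assert (0 < K * K) by (apply Rmult_lt_0_compat; auto); nra. }
  assert (Hq0 : forall w, (w < D)%nat -> 0 <= q w).
  { intros w Hw; apply inner_nonneg; auto. }
  assert (Hq1 : rsum D q = 1) by (unfold q, word_dist; rewrite rsum_inner; auto).
  assert (HAq : forall w i, (w < D)%nat -> (i < k)%nat -> U i = true ->
    A w i <= INR r / tau * q w).
  { intros w i Hw Hi Hu.
    assert (Hx : tau / INR r <= xs i).
    { apply Htr; split; auto. }
    assert (Hle : A w i * xs i <= q w).
    { apply (rsum_term_le k (fun i => A w i * xs i)); auto.
      intros j Hj; apply Rmult_le_pos; auto. }
    assert (A w i * (tau / INR r) <= A w i * xs i) by (apply Rmult_le_compat_l; auto).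
    apply Rle_trans with (INR r / tau * (A w i * (tau / INR r))).
    - apply Req_le; field; lra.
    - apply Rmult_le_compat_l; lra. }
  assert (Hinner : forall v w, (w < D)%nat -> (forall i, (i < k)%nat -> U i = false -> v i = 0) ->
    Rabs (inner k A w v) <= INR r / tau * q w * rsum k (fun i => Rabs (v i))).
  { intros v w Hw Hv; eapply Rle_trans; [apply Rabs_rsum|].
    rewrite <- rsum_scal; apply rsum_le; intros i Hi; rewrite Rabs_mult.
    destruct (U i) eqn:Hu.
    - apply Rmult_le_compat_r; [apply Rabs_pos|]; rewrite Rabs_right by (apply Rle_ge; auto).
      auto.
    - rewrite Hv, Rabs_R0 by auto; lra. }
  assert (HA2' : forall v, (forall i, (i < k)%nat -> U i = false -> v i = 0) ->
    rsum k (fun i => Rabs (v i)) <= kappa * rsum D (fun w => Rabs (inner k A w v))).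
  { intros v Hv; assert (Hsp : sparse k r v).
    { exists S; split; auto; intros i Hi Hvi; apply HS; auto.
      destruct (U i) eqn:Hu; [specialize (HUtrue i Hi Hu); lra|].
      exfalso; apply Hvi; auto. }
    specialize (HA2 v Hsp).
    apply Rmult_le_reg_l with (/ kappa); [now apply Rinv_0_lt_compat|].
    rewrite <- Rmult_assoc, Rinv_l, Rmult_1_l by lra.
    rewrite Rmult_comm; exact HA2. }
  (* Relative densities of the directions of zero sum on the support; the product [q w * z w] avoids
     dividing by a zero mass. *)
  set (V := fun z => exists v, (forall i, (i < k)%nat -> U i = false -> v i = 0) /\
    rsum k v = 0 /\ forall w, (w < D)%nat -> q w * z w = inner k A w v).
  set (b := fun i w => if U i then A w i / q w - 1 else 0).
  (* Where [q w = 0], [HAq] forces [A w i = 0], so the identity holds whatever the quotient is. *)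
  assert (HAzero : forall w i, (w < D)%nat -> (i < k)%nat -> U i = true ->
    q w * (A w i / q w) = A w i).
  { intros w i Hw Hi Hu; destruct (Hq0 w Hw) as [Hp|Hz]; [field; lra|].
    pose proof (HAq w i Hw Hi Hu) as Ha; pose proof (HA0 w i Hw Hi).
    rewrite <- Hz in *; lra. }
  assert (Hzero : V (fun _ => 0)).
  { exists (fun _ => 0); repeat split; auto; [apply rsum_zero|].
    intros w Hw; unfold inner; rewrite (rsum_ext k _ (fun _ => 0)), rsum_zero
      by (intros; ring); ring. }
  assert (HVadd : forall x y a, V x -> V y -> V (fun w => x w + a * y w)).
  { intros x y a (vx & Hx1 & Hx2 & Hx3) (vy & Hy1 & Hy2 & Hy3).
    exists (fun i => 1 * vx i + a * vy i); repeat split.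
    - intros i Hi Hu; rewrite Hx1, Hy1 by auto; ring.
    - rewrite rsum_plus, !rsum_scal, Hx2, Hy2; ring.
    - intros w Hw; rewrite inner_lincomb, <- Hx3, <- Hy3 by auto; ring. }
  assert (Hb : forall i, (i < k)%nat -> V (b i)).
  { intros i Hi; unfold b; destruct (U i) eqn:Hu; [|exact Hzero].
    (* The direction from [xs] to the vertex [i] of the simplex. *)
    exists (fun j => 1 * (if Nat.eqb j i then 1 else 0) + -1 * xs j); repeat split.
    - intros j Hj Huj; rewrite Hxs00 by auto.
      destruct (Nat.eqb_spec j i) as [->|]; [congruence|ring].
    - rewrite rsum_plus, (rsum_delta k (fun _ => 1) i Hi), rsum_scal, Hxs1; ring.
    - intros w Hw; rewrite inner_lincomb; change (inner k A w xs) with (q w).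
      unfold inner at 1; rewrite rsum_delta by auto.
      rewrite Rmult_minus_distr_l, (HAzero w i) by auto; ring. }
  assert (HVmean : forall z, V z -> Ex D q z = 0).
  { intros z (v & _ & Hv & Hz); rewrite <- Hv, <- (rsum_inner D k A v HA).
    now apply rsum_ext. }
  assert (HVsup : forall z, V z -> forall w, (w < D)%nat -> 0 < q w ->
    Rabs (z w) <= K * Ex D q (fun w => Rabs (z w))).
  { intros z (v & Hv0 & _ & Hz) w Hw Hp.
    assert (HE : rsum D (fun w => Rabs (inner k A w v)) = Ex D q (fun w => Rabs (z w))).
    { apply rsum_ext; intros u Hu; rewrite <- Hz, Rabs_mult, (Rabs_right (q u))
        by (auto; apply Rle_ge; auto); reflexivity. }
    rewrite <- HE; apply Rmult_le_reg_l with (q w); auto.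
    rewrite <- (Rabs_right (q w)) at 1 by lra; rewrite <- Rabs_mult, Hz by auto.
    eapply Rle_trans; [apply Hinner; auto|].
    replace (q w * (K * rsum D (fun w => Rabs (inner k A w v)))) with
      (INR r / tau * q w * (kappa * rsum D (fun w => Rabs (inner k A w v))))
      by (unfold K; ring).
    apply Rmult_le_compat_l; auto; apply Rmult_le_pos; lra. }
  eapply Rle_trans; [apply (likelihood_concentration D k n q K V U b); auto; try lra|].
  { intros i w Hu; unfold b; now rewrite Hu. }
  rewrite probE_expE; apply expE_le; auto; intros d Hd.
  unfold indicator; destruct (excluded_middle_informative _) as [Hgood|];
    destruct (excluded_middle_informative _) as [|Hbad]; try lra.
  exfalso; apply Hbad; split; [now apply (MLE_exists D k n)|]; intros x Hx.
  pose proof Hx as ((Hx0 & Hxns & Hx1) & _ & _).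
  assert (Hx00 : forall i, (i < k)%nat -> U i = false -> x i = 0) by (intros; apply Hxns; auto).
  set (z := lincomb k b x).
  assert (Hz : forall w, (w < D)%nat -> 0 < q w -> z w = inner k A w x / q w - 1).
  { intros w Hw Hp; unfold z, lincomb, inner.
    rewrite (rsum_ext k _ (fun i => / q w * (A w i * x i) - x i)).
    - rewrite rsum_minus, rsum_scal, Hx1; field; lra.
    - intros i Hi; unfold b; destruct (U i) eqn:Hu; [field; lra|rewrite Hx00; auto; ring]. }
  assert (Hzge : forall w, (w < D)%nat -> 0 < q w -> -1 <= z w).
  { intros w Hw Hp; rewrite Hz by auto.
    assert (0 <= inner k A w x / q w).
    { apply Rmult_le_pos; [apply inner_nonneg; auto|left; now apply Rinv_0_lt_compat]. }
    lra. }
  assert (Hrisk : INR n * hsq D q z <= 13824 * INR (length supp) * L).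
  { apply Hgood; auto; intros a Ha.
    apply (MLE_psi_nonneg D k n A xs x z d a); auto.
    destruct Hd as [_ Hd]; intros w Hw; destruct (Hd w Hw); now apply Hz. }
  assert (Hdist : dist_Ax D k A x xs = Ex D q (fun w => Rabs (z w))).
  { apply rsum_ext; intros w Hw; change (inner k A w xs) with (q w).
    destruct (Hq0 w Hw) as [Hp|Hp].
    - rewrite Hz, <- (Rabs_right (q w)) at 1 by (auto; lra).
      rewrite (Rabs_right (q w)) by lra.
      rewrite <- (Rabs_right (q w)) at 2 by lra; rewrite <- Rabs_mult.
      f_equal; field; lra.
    (* On a word of mass zero, [Hinner] forces [inner k A w x = 0]. *)
    - pose proof (Hinner x w Hw Hx00) as Hi; rewrite <- Hp in *.
      rewrite Rmult_0_l, Rminus_0_r; pose proof (Rabs_pos (inner k A w x)); lra. }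
  assert (HVz : V z) by (now apply lincomb_closed).
  pose proof (Ex_abs_sq_le_hsq D q z Hq0 Hq1 (HVmean z HVz) Hzge) as Hsq.
  rewrite <- Hdist in Hsq.
  (* The squared error is at most [2 * 13824 L s / n]; since [2 * 13824 L >= 1], this factor may be
     squared before taking the root. *)
  assert (HAx : dist_Ax D k A x xs <= 2 * 13824 * L ^ 1 * sqrt (INR r / INR n)).
  { assert (Hrn : 0 <= INR r / INR n) by (left; apply Rdiv_lt_0_compat; lra).
    eapply Rle_trans; [apply Rle_abs|]; apply Rabs_le_of_sq.
    - apply Rmult_le_pos; [simpl; lra|apply sqrt_pos].
    - replace (2 * 13824 * L ^ 1 * sqrt (INR r / INR n) *
        (2 * 13824 * L ^ 1 * sqrt (INR r / INR n)))
        with ((2 * 13824 * L) * (2 * 13824 * L) *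
              (sqrt (INR r / INR n) * sqrt (INR r / INR n))) by ring.
      rewrite sqrt_sqrt by auto.
      apply Rmult_le_reg_l with (INR n); auto.
      replace (INR n * (2 * 13824 * L * (2 * 13824 * L) * (INR r / INR n)))
        with (2 * 13824 * L * (2 * 13824 * L) * INR r) by (field; lra).
      apply Rle_trans with (2 * (13824 * INR (length supp) * L)).
      + nra.
      + apply Rle_trans with (2 * 13824 * L * 1 * INR r); [nra|].
        apply Rmult_le_compat_r; [lra|]; apply Rmult_le_compat_l; lra. }
  split; [exact HAx|].
  apply Rle_trans with (kappa * dist_Ax D k A x xs).
  - assert (Hdx : dist_Ax D k A x xs =
      rsum D (fun w => Rabs (inner k A w (fun i => 1 * x i + -1 * xs i)))).
    { apply rsum_ext; intros; rewrite inner_lincomb; f_equal; ring. }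
    rewrite Hdx; eapply Rle_trans; [|apply HA2'].
    + apply rsum_le; intros i Hi; apply Req_le; f_equal; ring.
    + intros i Hi Hu; rewrite Hx00, Hxs00 by auto; ring.
  - apply Rmult_le_compat_l with (r := kappa) in HAx; [|lra].
    eapply Rle_trans; [exact HAx|]; apply Req_le; ring.
Qed.

(** Below the threshold on [k] the value 1 leaves only the nonnegativity of a probability to
    prove. *)
Definition failure_bound (k : nat) : R :=
  if Rle_dec 41472 (INR k) then 2 / ln (INR k) else 1.

Lemma failure_bound_cv : Un_cv failure_bound 0.
Proof.
  intros eps Heps.
  destruct (INR_unbounded (Rmax 41472 (exp (2 / eps)))) as [N HN].
  exists N; intros k Hk; apply le_INR in Hk.
  pose proof (Rmax_l 41472 (exp (2 / eps))); pose proof (Rmax_r 41472 (exp (2 / eps))).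
  unfold failure_bound; destruct (Rle_dec 41472 (INR k)) as [Hk'|]; [|lra].
  assert (Hln : 2 / eps < ln (INR k)).
  { rewrite <- (ln_exp (2 / eps)); apply ln_increasing; [apply exp_pos|lra]. }
  assert (H2 : 0 < 2 / eps) by (apply Rdiv_lt_0_compat; lra).
  unfold R_dist, Rdist; rewrite Rminus_0_r, Rabs_right
    by (apply Rle_ge, Rlt_le, Rdiv_lt_0_compat; lra).
  apply Rmult_lt_reg_r with (ln (INR k)); [lra|].
  unfold Rdiv; rewrite Rmult_assoc, Rinv_l, Rmult_1_r by lra.
  apply Rmult_lt_compat_l with (r := eps) in Hln; auto.
  replace (eps * (2 / eps)) with 2 in Hln by (field; lra); lra.
Qed.

Theorem theorem5p1 :
  exists (c C : R) (p : nat) (delta : nat -> R),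
    0 < c /\ 0 < C /\ Un_cv delta 0 /\
    forall (k D r : nat) (tau kappa : R) (A : nat -> nat -> R) (xs : nat -> R) (n : nat),
      word_topic D k A ->
      in_simplex k xs ->
      0 < tau <= 1 ->
      0 < kappa ->
      assumption_A1 k r tau xs ->
      assumption_A2 D k r kappa A ->
      c * kappa ^ 2 * INR r ^ 2 * ln (INR k) / tau ^ 2 <= INR n ->
      1 - delta k <=
      probE (word_dist k A xs) D n
        (fun doc =>
           (exists x, is_MLE k A xs doc x) /\
           forall x, is_MLE k A xs doc x ->
             dist_Ax D k A x xs <= C * ln (INR k) ^ p * sqrt (INR r / INR n) /\
             dist_x k x xs <= C * ln (INR k) ^ p * kappa * sqrt (INR r / INR n)).
Proof.
  (* The first constant is that of [2 * 13824 K^2 ln k <= n]; the second combines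
     [(E|z|)^2 <= 2 hsq] with the bound on [n * hsq]. *)
  exists (2 * 13824), (2 * 13824), 1%nat, failure_bound.
  split; [lra|split; [lra|split; [exact failure_bound_cv|]]].
  intros k D r tau kappa A xs n HA Hxs Htau Hkappa HA1 HA2 Hn.
  unfold failure_bound; destruct (Rle_dec 41472 (INR k)) as [Hk|_].
  - now apply (MLE_risk_bound D k r n tau).
  - replace (1 - 1) with 0 by ring; rewrite probE_expE.
    rewrite <- (expE_const (word_dist k A xs) D n 0).
    + apply expE_le.
      * intros w Hw; destruct HA as [HA0 _], Hxs as [Hxs0 _]; apply inner_nonneg; auto.
      * intros d _; unfold indicator; destruct (excluded_middle_informative _); lra.
    + unfold word_dist; rewrite rsum_inner by auto; apply Hxs.
Qed.
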